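(* Let $r,n\ge 1$ be integers and $q\ge 2$ a prime power. For a prime power $Q$ and $m\ge 0$ write $\mathrm{P}_m(\mathbb{F}_Q)=Q^{\binom{r+m}{r}-1}\,\frac{1-Q^{-\binom{r-1+m}{r-1}}}{1-Q^{-1}}$, and let $\mathrm{I}_m(\mathbb{F}_Q)=\#I_{r,m}(\mathbb{F}_Q)$, $\mathrm{A}_m(\mathbb{F}_Q)=\#A_{r,m}(\mathbb{F}_Q)$, $\mathrm{E}_m(\mathbb{F}_Q)=\#E_{r,m}(\mathbb{F}_Q)$. Then $\mathrm{A}_0(\mathbb{F}_q)=0$, $\mathrm{E}_0(\mathbb{F}_q)=0$, $$\mathrm{A}_n(\mathbb{F}_q)=-\sum_{s\mid k\mid n}\frac{\mu(s)}{k}\sum_{m\mid n/k}\frac{\mu(m)}{m}\sum_{j\in M_{n/(km)}}\frac{(-1)^{|j|}}{|j|}\,\mathrm{P}_{j_1}(\mathbb{F}_{q^s})\mathrm{P}_{j_2}(\mathbb{F}_{q^s})\cdots\mathrm{P}_{j_{|j|}}(\mathbb{F}_{q^s}),$$ and $$\mathrm{E}_n(\mathbb{F}_q)=-\sum_{1<k\mid n}\frac1k\sum_{s\mid k}\mu(s)\,\mathrm{I}_{n/k}(\mathbb{F}_{q^s}) =\sum_{1<k\mid n}\frac1k\sum_{\substack{s\mid k\\ m\mid n/k}}\frac{\mu(s)\mu(m)}{m}\sum_{j\in M_{n/(km)}}\frac{(-1)^{|j|}}{|j|}\,\mathrm{P}_{j_1}(\mathbb{F}_{q^s})\mathrm{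P}_{j_2}(\mathbb{F}_{q^s})\cdots\mathrm{P}_{j_{|j|}}(\mathbb{F}_{q^s}).$$
   Context: $\mathbb{F}_Q$ is the finite field with $Q$ elements. Fix a monomial order (say degree-lexicographic) in the variables $x_1,\dots,x_r$; a polynomial is monic if its leading coefficient is $1$. For a field $F$, $P_{r,n}(F)$ is the set of monic polynomials in $F[x_1,\dots,x_r]$ of total degree exactly $n$ (of cardinality $\mathrm{P}_n(\mathbb{F}_Q)$ for $F=\mathbb{F}_Q$), $I_{r,n}(F)\subseteq P_{r,n}(F)$ is the subset of polynomials irreducible over $F$ (with $I_{r,0}(F)=\varnothing$), $A_{r,n}(F)\subseteq I_{r,n}(F)$ is the subset of absolutely irreducible polynomials (irreducible over an algebraic closure of $F$), and $E_{r,n}(F)=I_{r,n}(F)\setminus A_{r,n}(F)$ is the set of relatively irreducible polynomials. $\mu$ is the Möbius function. For a positive integer $i$, $M_i$ is the set of compositions of $i$, i.e. finite sequences $j=(j_1,\dots,j_{|j|})$ of positive integers with sum $i$, where $|j|$ is the length. *)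

(* Defs.v *)
From HB Require Import structures.
From mathcomp Require Import all_boot all_order all_algebra closed_field finmap.
From mathcomp Require Import boolp classical_sets functions cardinality.
From mathcomp Require Import mpoly.

Set Implicit Arguments.
Unset Strict Implicit.
Unset Printing Implicit Defensive.

Import GRing.Theory.

Local Open Scope classical_set_scope.
Local Open Scope ring_scope.

Definition prime_power (q : nat) : Prop :=
  exists p e : nat, [/\ prime p, (0 < e)%N & q = (p ^ e)%N].

(* Only meant for n > 0. *)
Definition mobius (n : nat) : int :=
  if all (fun p => logn p n == 1%N) (primes n)
  then (-1) ^+ size (primes n) else 0.

(* The parts and the length of a composition of i are at most i, so it is
   enough to filter the sequences of length at most i over {0, ..., i}. *)
Definition compositions (i : nat) : seq (seq nat) :=
  [seq j <- [seq [seq val a | a <- val t]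
              | l <- iota 0 i.+1, t <- enum {: l.-tuple 'I_i.+1}]
   | (0%N \notin j) && (sumn j == i)].

Lemma mem_compositions (i : nat) (j : seq nat) :
  (j \in compositions i) = (0%N \notin j) && (sumn j == i).
Proof.
rewrite mem_filter andb_idr // => /andP[j0 /eqP ji].
have szj : (size j <= i)%N.
  rewrite -ji; elim: j j0 {ji} => //= a j IH; rewrite inE negb_or => /andP[a0 j0].
  by rewrite -add1n leq_add ?IH // lt0n eq_sym.
have lej a : a \in j -> (a < i.+1)%N.
  rewrite ltnS -ji; elim: j {j0 ji szj} => //= b j IH; rewrite inE.
  by case/predU1P=> [->|/IH h]; [exact: leq_addr | exact: leq_trans h (leq_addl _ _)].
have szt : size [seq (inord a : 'I_i.+1) | a <- j] == size j by rewrite size_map.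
apply/allpairsPdep; exists (size j), (Tuple szt).
rewrite mem_iota ltnS szj mem_enum; split => //=.
rewrite -map_comp -[LHS]map_id; apply/eq_in_map => a ja /=.
by rewrite inordK ?lej.
Qed.

Lemma uniq_compositions (i : nat) : uniq (compositions i).
Proof.
apply/filter_uniq/allpairs_uniq_dep => [|l _|]; rewrite ?iota_uniq ?enum_uniq //.
move=> [l t] [l' t'] _ _ /= /(inj_map val_inj) tt'.
have ll' : l = l' by rewrite -(size_tuple t) tt' size_tuple.
by case: _ / ll' t' tt' => t' /val_inj ->.
Qed.

Definition irreducible_elt (R : unitRingType) (p : R) : Prop :=
  [/\ p != 0, p \isn't a GRing.unit &
      forall a b : R, p = a * b -> a \is a GRing.unit \/ b \is a GRing.unit].

Definition alg_closure (F : countFieldType) : countClosedFieldType :=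
  projT1 (countable_algebraic_closure F).

Definition to_alg_closure (F : countFieldType) :
    {rmorphism F -> alg_closure F} :=
  sval (projT2 (countable_algebraic_closure F)).

Definition absolutely_irreducible (F : countFieldType) (r : nat)
    (p : {mpoly F[r]}) : Prop :=
  irreducible_elt (map_mpoly (to_alg_closure F) p).

(* [mlead] is the leading monomial for the degree-lexicographic order, and
   [msize p] is one more than the total degree of [p]. *)
Definition monic_polys (F : fieldType) (r n : nat) : set {mpoly F[r]} :=
  [set p | msize p = n.+1 /\ p@_(mlead p) = 1].

Definition irr_polys (F : fieldType) (r n : nat) : set {mpoly F[r]} :=
  [set p | monic_polys n p /\ irreducible_elt p].

Definition abs_irr_polys (F : countFieldType) (r n : nat) : set {mpoly F[r]} :=
  [set p | irr_polys n p /\ absolutely_irreducible p].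

Definition rel_irr_polys (F : countFieldType) (r n : nat) : set {mpoly F[r]} :=
  irr_polys n `\` abs_irr_polys n.

(* [fset_set] is a junk value on infinite sets; this lemma rules that out for
   the subsets counted below. *)
Lemma finite_monic_polys (F : finFieldType) (r n : nat) :
  finite_set (monic_polys n : set {mpoly F[r]}).
Proof.
pose g (f : {ffun 'X_{1..r < n.+1} -> F}) : {mpoly F[r]} :=
  \sum_(m : 'X_{1..r < n.+1}) f m *: 'X_[m].
apply: (@sub_finite_set _ _ (g @` setT)); last exact/finite_image/finite_finset.
move=> p [szp _]; exists [ffun m : 'X_{1..r < n.+1} => p@_m] => //.
rewrite /g [RHS](mpolywE (k := n.+1)) ?szp //.
by apply: eq_bigr => m _; rewrite ffunE.
Qed.

Definition num_irr (F : finFieldType) (r m : nat) : nat :=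
  #|` fset_set (irr_polys m : set {mpoly F[r]})|%fset.

Definition num_abs_irr (F : finFieldType) (r m : nat) : nat :=
  #|` fset_set (abs_irr_polys m : set {mpoly F[r]})|%fset.

Definition num_rel_irr (F : finFieldType) (r m : nat) : nat :=
  #|` fset_set (rel_irr_polys m : set {mpoly F[r]})|%fset.

Definition num_monic (r m Q : nat) : rat :=
  Q%:R ^+ ('C(r + m, r) - 1) *
  ((1 - Q%:R ^- 'C(r - 1 + m, r - 1)) / (1 - Q%:R^-1)).

(* Main.v *)
(* Over any field, polynomials in several variables factor uniquely (induction
   on the number of variables and Gauss's lemma).  Let tau be an automorphism
   of a field L, let P_n be the number of monic polynomials of degree n over L
   fixed by tau, and let a_d(j) be the number of monic irreducible polynomials
   of degree d over L fixed by tau^j.  The fixed polynomials factor uniquely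
   into products over tau-orbits of irreducible polynomials, and the logarithmic
   derivative of the resulting Euler product reads
     n P_n = sum_(1 <= m <= n) (sum_(d | m) d a_d(m/d)) P_(n-m).
   Hence sum_(d | m) d a_d(m/d) is m times the coefficient l_m of t^m in
   log (sum_n P_n t^n).
   The case of F_(q^s) with tau the identity gives
     m l_m(q^s) = sum_(d | m) d I_d(F_(q^s)),
   while an algebraic closure of F_q with tau the q^s-power map gives
     m l_m(q^s) = sum_(d | m) d A_d(s m/d),
   where A_d(t) counts the monic absolutely irreducible polynomials of degree d
   with coefficients in F_(q^t).  Eliminating l by Moebius inversion yields both
   formulas. *)
Require Import Defs.
From HB Require Import structures.
From mathcomp Require Import all_boot all_order all_algebra closed_field finmap.
From mathcomp Require Import boolp classical_sets functions cardinality.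
From mathcomp Require Import mpoly finfield.
From mathcomp Require Import ring zify.

Set Implicit Arguments.
Unset Strict Implicit.
Unset Printing Implicit Defensive.

Import Order.TTheory GRing.Theory Num.Theory.

Local Open Scope ring_scope.

(** * Unique factorization *)

Section Divisibility.
Variable R : idomainType.
Implicit Types (a b p u x : R) (s : seq R).

Definition divides p a : Prop := exists c, a = c * p.

Lemma divides_refl a : divides a a.
Proof. by exists 1; rewrite mul1r. Qed.

Lemma divides_mull p a b : divides p b -> divides p (a * b).
Proof. by case=> c ->; exists (a * c); rewrite mulrA. Qed.

Lemma divides_mulr p a b : divides p a -> divides p (a * b).
Proof. by rewrite mulrC; apply: divides_mull. Qed.

Lemma divides_trans b a c : divides a b -> divides b c -> divides a c.
Proof. by move=> ab [d ->]; apply: divides_mull. Qed.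

Lemma divides_add p a b : divides p a -> divides p b -> divides p (a + b).
Proof. by case=> c -> [d ->]; exists (c + d); rewrite mulrDl. Qed.

Lemma divides_sub p a b : divides p a -> divides p b -> divides p (a - b).
Proof. by case=> c -> [d ->]; exists (c - d); rewrite mulrBl. Qed.

Definition prime_elt p : Prop :=
  [/\ p != 0, p \isn't a GRing.unit &
      forall a b, divides p (a * b) -> divides p a \/ divides p b].

Lemma prime_irreducible p : prime_elt p -> irreducible_elt p.
Proof.
case=> p0 pU pP; split=> // a b pab.
have : divides p (a * b) by rewrite -pab; apply: divides_refl.
have swap c d : p = c * d -> divides p c -> d \is a GRing.unit.
  move=> pcd [e ce]; apply/unitrPr; exists e.
  by apply: (mulIf p0); rewrite mul1r {2}pcd ce; ring.
case/pP=> [/(swap _ _ pab)|]; first by right.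
by move=> pb; left; apply: swap pb; rewrite mulrC.
Qed.

Lemma prime_associate p u : u \is a GRing.unit -> prime_elt p ->
  prime_elt (u * p).
Proof.
move=> uU [p0 pU pP].
have dvdE a : divides (u * p) a <-> divides p a.
  split=> [[c ->]|[c ->]]; first by exists (c * u); rewrite mulrA.
  by exists (c / u); rewrite mulrA divrK.
split; rewrite ?mulf_neq0 ?unitrMr //; first by apply: contraTneq uU => ->; rewrite unitr0.
by move=> a b /dvdE/pP; rewrite !dvdE.
Qed.

(** Only existence is asked for: the factors are prime, not just irreducible, and this makes a
    factorization unique up to order and units. *)
Definition factorial_ring : Prop := forall x, x != 0 ->
  exists u s, [/\ u \is a GRing.unit, (forall p, p \in s -> prime_elt p)
                & x = u * \prod_(p <- s) p].

(** Split one prime off the factorization of [p]: by irreducibility the cofactor is a unit, so [p]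
    is associate to that prime. *)
Lemma factorial_irreducible_prime p :
  factorial_ring -> irreducible_elt p -> prime_elt p.
Proof.
move=> facR [p0 pU pP]; have [u [[|t s] [uU sP pE]]] := facR p p0.
  by rewrite pE big_nil mulr1 uU in pU.
have tP : prime_elt t by apply: sP; rewrite inE eqxx.
have pE' : p = (u * \prod_(x <- s) x) * t.
  by rewrite pE big_cons; ring.
case: (pP _ _ pE') => [vU|tU]; last by case: tP; rewrite tU.
by rewrite pE'; apply: prime_associate.
Qed.

End Divisibility.

(** * Gauss's lemma: irreducible polynomials over a factorial ring are prime *)

Section Gauss.
Variable R : idomainType.
Hypothesis facR : factorial_ring R.
Implicit Types (a b x y : {poly R}) (c p : R).

Lemma size_drop_lead a : a != 0 ->
  (size (a - lead_coef a *: 'X^((size a).-1))%R < size a)%N.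
Proof.
move=> a0; have sz : (size a).-1.+1 = size a by rewrite prednK // size_poly_gt0.
rewrite -[X in (_ < X)%N]sz ltnS; apply/leq_sizeP => j.
rewrite leq_eqVlt => /predU1P[<-|ltj]; rewrite coefB coefZ coefXn.
  by rewrite eqxx mulr1 lead_coefE subrr.
by rewrite gtn_eqF // mulr0 subr0 nth_default // -sz.
Qed.

(** Induction on the total size of [a] and [b]. The prime [p] divides the leading coefficient of
    [a * b], hence that of [a] or of [b]; dropping that leading term keeps the product divisible. *)
Lemma prime_polyC p : prime_elt p -> prime_elt p%:P.
Proof.
case=> p0 pU pP; split; rewrite ?polyC_eq0 //.
  by rewrite poly_unitE coefC size_polyC p0.
move=> a b; have [n] := ubnP (size a + size b).
have zero : divides p%:P 0 by exists 0; rewrite mul0r.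
elim: n a b => // n IHn a b; rewrite ltnS => szn dab.
have [->|a0] := eqVneq a 0; first by left.
have [->|b0] := eqVneq b 0; first by right.
have lead x : divides p (lead_coef x) ->
    divides p%:P (lead_coef x *: 'X^((size x).-1)).
  by case=> d ->; exists (d *: 'X^((size x).-1)); rewrite [RHS]mulrC mul_polyC scalerA mulrC.
have back x y : divides p%:P y -> divides p%:P (x - y) -> divides p%:P x.
  by move=> dy dxy; rewrite -(subrK y x); apply: divides_add.
have [d abd] := dab.
have : divides p (lead_coef a * lead_coef b).
  by exists (lead_coef d); rewrite -lead_coefM abd lead_coefM lead_coefC.
case/pP => /lead dl.
- have : divides p%:P ((a - lead_coef a *: 'X^((size a).-1)) * b).
    by rewrite mulrBl; apply: divides_sub => //; apply: divides_mulr.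
  case/IHn => [||?]; [|by left; apply: back dl _|by right].
  by apply: leq_trans szn; rewrite ltn_add2r size_drop_lead.
- have : divides p%:P (a * (b - lead_coef b *: 'X^((size b).-1))).
    by rewrite mulrBr; apply: divides_sub => //; apply: divides_mull.
  case/IHn => [|?|]; [|by left|by right; apply: back dl _].
  by apply: leq_trans szn; rewrite ltn_add2l size_drop_lead.
Qed.

(* Gauss's lemma: each prime factor of [c] divides [a] or [b], and cancels. *)
Lemma scaled_factorization c x a b : c != 0 -> c *: x = a * b ->
  exists ca cb a' b', [/\ x = a' * b', a = ca *: a' & b = cb *: b'].
Proof.
move=> /facR[u [s [uU sP ->]]].
elim: s sP x a b => [|p s IHs] sP x a b.
  rewrite big_nil mulr1 => xab; exists u, 1, (u^-1 *: a), b; split.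
  - by rewrite -scalerAl -xab scalerA mulVr // scale1r.
  - by rewrite scalerA divrr // scale1r.
  - by rewrite scale1r.
have pP : prime_elt p by apply: sP; rewrite inE eqxx.
have {}IHs := IHs (fun t ts => sP t (mem_behead (s := p :: s) ts)).
rewrite big_cons => xab.
have [p0 _ _] := pP; have [_ _ /(_ a b)] := prime_polyC pP.
have cancel y z : p *: y = p *: z -> y = z.
  by move/eqP; rewrite -subr_eq0 -scalerBr scale_poly_eq0 (negPf p0) subr_eq0 => /eqP.
case=> [|[d ad]|[d bd]].
- exists ((u * \prod_(j <- s) j) *: x); rewrite -xab [RHS]mulrC mul_polyC scalerA.
  by congr (_ *: _); ring.
- have /IHs[ca [cb [a' [b' [-> dE ->]]]]] : (u * \prod_(j <- s) j) *: x = d * b.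
    apply: cancel; rewrite scalerA [p * _]mulrCA xab ad.
    by rewrite -[p *: _]mul_polyC; ring.
  by exists (p * ca), cb, a', b'; split=> //; rewrite ad dE [LHS]mulrC mul_polyC scalerA.
- have /IHs[ca [cb [a' [b' [-> -> dE]]]]] : (u * \prod_(j <- s) j) *: x = a * d.
    apply: cancel; rewrite scalerA [p * _]mulrCA xab bd.
    by rewrite -[p *: _]mul_polyC; ring.
  by exists ca, (p * cb), a', b'; split=> //; rewrite bd dE [LHS]mulrC mul_polyC scalerA.
Qed.

(** Pseudo-division gives [c *: a = q * x]; [scaled_factorization] absorbs [c] and leaves [x] as a
    constant [cb] times a factor of [a]. Since [x] is irreducible and not constant, [cb] is a
    unit. *)
Lemma pseudo_divides_irreducible x a : irreducible_elt x -> (1 < size x)%N ->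
  Pdiv.Idomain.dvdp x a -> divides x a.
Proof.
move=> [x0 xU xP] szx /Pdiv.Idomain.dvdpP[[c q] /= c0 caq].
have [ca [cb [a' [b' [-> _ xE]]]]] := scaled_factorization c0 caq.
have szb : size b' = size x.
  rewrite xE size_scale //; apply: contraNneq x0 => cb0.
  by rewrite xE cb0 scale0r.
have := xE; rewrite -mul_polyC => /xP[cbU|]; last first.
  by rewrite poly_unitE szb => /andP[/eqP xs1]; rewrite xs1 in szx.
apply: divides_mull; exists (cb%:P^-1).
by rewrite xE -mul_polyC mulKr.
Qed.

Lemma poly_irreducible_prime x : irreducible_elt x -> prime_elt x.
Proof.
move=> xI; have [x0 xU xP] := xI; have [/size1_polyC xC|szx] := leqP (size x) 1.
  rewrite xC; apply/prime_polyC/factorial_irreducible_prime => //.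
  have CU c : (c%:P \is a GRing.unit) = (c \is a GRing.unit).
    by rewrite poly_unitE coefC size_polyC; have [->|] := eqVneq c 0; rewrite ?unitr0.
  split; first by rewrite -polyC_eq0 -xC.
    by rewrite -CU -xC.
  by move=> a b ab; rewrite -!CU; apply: xP; rewrite -polyCM -ab.
split=> // a b [c abc].
have dab : Pdiv.Idomain.dvdp x (a * b).
  by apply/Pdiv.Idomain.dvdpP; exists (1, c); rewrite ?oner_eq0 //= scale1r.
have [cop|ncop] := boolP (Pdiv.Idomain.coprimep x a).
  right; apply: pseudo_divides_irreducible => //.
  by rewrite -(Pdiv.Idomain.Gauss_dvdpr _ cop).
(* The gcd [g] is not constant and divides [x] up to a scalar. By irreducibility its rescaled form
   [g'] is associate to [x], so [x] pseudo-divides [g] and thus [a]. *)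
left; apply: pseudo_divides_irreducible => //.
set g := Pdiv.Idomain.gcdp x a in ncop *.
have ga : Pdiv.Idomain.dvdp g a by apply: Pdiv.Idomain.dvdp_gcdr.
have /Pdiv.Idomain.dvdpP[[d h] /= d0 dxh] : Pdiv.Idomain.dvdp g x.
  by apply: Pdiv.Idomain.dvdp_gcdl.
have [ch [cg [h' [g' [xE hE gE]]]]] := scaled_factorization d0 dxh.
have g0 : g != 0 by rewrite Pdiv.Idomain.gcdp_eq0 (negPf x0).
have cg0 : cg != 0 by apply: contraNneq g0 => cg0; rewrite gE cg0 scale0r.
have szg : size g' != 1 by rewrite -(size_scale g' cg0) -gE.
case: (xP _ _ xE) => [h'U|]; last by rewrite poly_unitE (negPf szg).
have xg : Pdiv.Idomain.dvdp x g.
  apply/Pdiv.Idomain.dvdpP; exists (1, (cg%:P / h')); rewrite ?oner_eq0 //=.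
  by rewrite scale1r xE gE -mul_polyC mulrA divrK.
exact: Pdiv.Idomain.dvdp_trans xg ga.
Qed.

End Gauss.

(** * Polynomials in [n.+1] variables as univariate polynomials over [n] variables *)

Section MuniIso.
Variables (n : nat) (R : idomainType).
Implicit Types p : {mpoly R[n.+1]}.

Let widen : 'I_n -> 'I_n.+1 := widen_ord (leqnSn n).

Lemma muniX (m : 'X_{1..n.+1}) :
  muni 'X_[R, m] = 'X_[[multinom m (widen i) | i < n]] *: 'X^(m ord_max).
Proof. by rewrite muniE msuppX big_seq1 mcoeffX eqxx scale1r. Qed.

(** The inverse of [muni]: read the coefficients in [n.+1] variables and substitute the last
    variable for ['X]. *)
Let eval (P : {poly {mpoly R[n]}}) : {mpoly R[n.+1]} :=
  (map_poly (@mwiden n R) P).['X_ord_max].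

Let evalM : {morph eval : P Q / P * Q}.
Proof. by move=> P Q; rewrite /eval rmorphM /= hornerM. Qed.

Let evalD : {morph eval : P Q / P + Q}.
Proof. by move=> P Q; rewrite /eval rmorphD /= hornerD. Qed.

Let evalC c : eval c%:P = mwiden c.
Proof. by rewrite /eval map_polyC hornerC. Qed.

Let evalX : eval 'X = 'X_ord_max.
Proof. by rewrite /eval map_polyX hornerX. Qed.

Let muni_mwiden (c : {mpoly R[n]}) : muni (mwiden c) = c%:P.
Proof.
rewrite {1}[c]mpolyE [mwiden _]raddf_sum [muni _]raddf_sum [in RHS](mpolyE c) [RHS]raddf_sum /=.
apply: eq_bigr => m _; rewrite mwidenZ mwidenX muniZ muniX mnmwiden_ordmax.
rewrite expr0 -mul_polyC -[_ *: 1]mul_polyC mulr1 -polyCM mul_mpolyC.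
congr (_ *: 'X_[_])%:P; apply/mnmP => i.
by rewrite mnmE mnmwiden_widen.
Qed.

Let muni_eval P : muni (eval P) = P.
Proof.
elim/poly_ind: P => [|P c IH]; first by rewrite /eval rmorph0 horner0 muni0.
rewrite evalD evalM evalX evalC muniD muniM IH muni_mwiden muniX.
congr (_ * _ + _); rewrite mnm1E eqxx expr1.
suff -> : [multinom U_(ord_max)%MM (widen i) | i < n] = 0%MM by rewrite mpolyX0 scale1r.
by apply/mnmP => i; rewrite mnmE mnm1E mnm0E -val_eqE /= gtn_eqF.
Qed.

Let eval_muni p : eval (muni p) = p.
Proof.
rewrite {1}[p]mpolyE [RHS]mpolyE raddf_sum.
(* Exhibits [eval] as a composition of additive maps, so that it passes through the sum. *)
have -> : eval = (horner_eval 'X_ord_max \o map_poly (@mwiden n R)) :> (_ -> _) by [].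
rewrite raddf_sum /=; apply: eq_bigr => m _.
rewrite -[horner_eval _ _]/(eval _) muniZ muniX -!mul_polyC !evalM !evalC.
rewrite mwidenC mwidenX mul_mpolyC; congr (_ *: _).
have -> k : eval 'X^k = 'X_ord_max ^+ k.
  by rewrite /eval map_polyXn hornerXn.
rewrite mpolyXn -mpolyXD; congr 'X_[_]; apply/mnmP => i.
rewrite mnmDE mulmnE mnm1E; case: (unliftP ord_max i) => [j|] ->.
  have -> : lift ord_max j = widen j by apply/val_inj; rewrite /= /bump leqNgt ltn_ord.
  by rewrite mnmwiden_widen mnmE -val_eqE /= gtn_eqF // mul0n addn0.
by rewrite mnmwiden_ordmax eqxx mul1n.
Qed.

Lemma muni_bij : bijective (@muni n R).
Proof. by exists eval. Qed.

End MuniIso.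

(** * Polynomial rings over a field are factorial *)

Section MpolyFactorial.

Lemma rmorph_bij_irreducible (A B : unitRingType) (f : {rmorphism A -> B})
    (x : A) : bijective f -> irreducible_elt x -> irreducible_elt (f x).
Proof.
move=> [g fK gK] [x0 xU xP].
have fU y : (f y \is a GRing.unit) = (y \is a GRing.unit).
  apply/idP/idP => [|/(rmorph_unit f)//]; case/unitrP => z [zy yz].
  by apply/unitrP; exists (g z); split; apply: (can_inj fK);
    rewrite rmorphM gK ?zy ?yz rmorph1.
split; rewrite ?fU //; first by rewrite -(rmorph0 f) (can_eq fK).
move=> a b fxab; rewrite -[a]gK -[b]gK !fU; apply: xP.
by apply: (can_inj fK); rewrite rmorphM !gK.
Qed.

Lemma rmorph_bij_irreducible_prime (A B : idomainType) (f : {rmorphism A -> B}) :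
  bijective f -> (forall y : B, irreducible_elt y -> prime_elt y) ->
  forall x : A, irreducible_elt x -> prime_elt x.
Proof.
move=> f_bij prB x xI; have [x0 xU _] := xI.
have [_ _ fxP] := prB _ (rmorph_bij_irreducible f_bij xI).
have [g fK gK] := f_bij.
have fD y z : divides (f y) (f z) <-> divides y z.
  split=> [[c zE]|[c ->]]; last by exists (f c); rewrite rmorphM.
  by exists (g c); apply: (can_inj fK); rewrite rmorphM gK.
by split=> // a b; rewrite -!fD rmorphM; apply: fxP.
Qed.

Variable F : fieldType.

Lemma mpoly_unit_msize n (p : {mpoly F[n]}) :
  (p \is a GRing.unit) = (msize p == 1%N).
Proof.
apply/idP/eqP => [/andP[/eqP pE]|/eqP/msize_poly1P[c c0 ->]].
  by rewrite unitfE => p0; rewrite pE msizeC p0.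
by apply/andP; rewrite mcoeffC eqxx mulr1 unitfE.
Qed.

Lemma msize_factor n (a b : {mpoly F[n]}) : a * b != 0 ->
  b \isn't a GRing.unit -> (msize a < msize (a * b))%N.
Proof.
rewrite mulf_eq0 negb_or mpoly_unit_msize => /andP[a0 b0] bU.
rewrite msizeM //; move: bU; rewrite (mpolySpred _ a0) (mpolySpred _ b0).
by case: (_.-1) => // k _; lia.
Qed.

(** Induction on [msize]: a nonzero nonunit is irreducible, hence prime by hypothesis, or a product
    of two nonunits of smaller size. *)
Lemma mpoly_atomic n (p : {mpoly F[n]}) :
  (forall x : {mpoly F[n]}, irreducible_elt x -> prime_elt x) -> p != 0 ->
  exists u s, [/\ u \is a GRing.unit, (forall x, x \in s -> prime_elt x)
                & p = u * \prod_(x <- s) x].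
Proof.
move=> irrP; have [k] := ubnP (msize p); elim: k p => // k IHk p.
rewrite ltnS => szp p0.
have [pU|pU] := boolP (p \is a GRing.unit).
  by exists p, [::]; rewrite big_nil mulr1.
have [pI|] := pselect (irreducible_elt p).
  exists 1, [:: p]; split; rewrite ?unitr1 ?big_seq1 ?mul1r //.
  by move=> x; rewrite inE => /eqP->; apply: irrP.
move=> pNI; have [[a [b [pab aU bU]]]|none] := pselect (exists a b,
    [/\ p = a * b, a \isn't a GRing.unit & b \isn't a GRing.unit]); last first.
  case: pNI; split=> // a b pab; apply: contrapT => nU; apply: none.
  by exists a, b; split=> //; apply/negP => U; apply: nU; [left|right].
have ab0 : a * b != 0 by rewrite -pab.
have [a0 b0] : a != 0 /\ b != 0 by apply/andP; rewrite -negb_or -mulf_eq0.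
have [u [s [uU sP aE]]] : exists u s, [/\ u \is a GRing.unit,
    (forall x, x \in s -> prime_elt x) & a = u * \prod_(x <- s) x].
  by apply: IHk => //; apply: leq_trans szp; rewrite pab msize_factor.
have [v [t [vU tP bE]]] : exists u s, [/\ u \is a GRing.unit,
    (forall x, x \in s -> prime_elt x) & b = u * \prod_(x <- s) x].
  apply: IHk => //; apply: leq_trans szp.
  by rewrite pab mulrC msize_factor // mulrC.
exists (u * v), (s ++ t); split; first by rewrite unitrM uU.
  by move=> x; rewrite mem_cat => /orP[/sP|/tP].
by rewrite pab aE bE big_cat /=; ring.
Qed.

Theorem mpoly_factorial n : factorial_ring {mpoly F[n]}.
Proof.
elim: n => [|n IHn] p p0.
  (* In zero variables every nonzero polynomial is a constant, hence a unit. *)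
  exists p, [::]; rewrite big_nil mulr1; split=> //.
  rewrite mpoly_unit_msize eqn_leq lt0n msize_poly_eq0 p0 andbT.
  by rewrite msizeE; apply/bigmax_leqP_seq => m _ _; rewrite mdegE big_ord0.
apply: mpoly_atomic => //.
exact/(rmorph_bij_irreducible_prime (muni_bij n F))/poly_irreducible_prime.
Qed.

Lemma mpoly_irreducible_prime n (p : {mpoly F[n]}) :
  irreducible_elt p -> prime_elt p.
Proof. exact/factorial_irreducible_prime/mpoly_factorial. Qed.

End MpolyFactorial.

(** * Monic polynomials and their factorizations *)

Section FsetSet.

Lemma in_fset_setP (T : choiceType) (A : set T) x :
  finite_set A -> (x \in fset_set A) <-> A x.
Proof. by move=> finA; rewrite in_fset_set // inE. Qed.

Lemma card_fset_set_seq (T : choiceType) (A : set T) (s : seq T) :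
  finite_set A -> uniq s -> (forall x, x \in s <-> A x) ->
  #|` fset_set A|%fset = size s.
Proof.
move=> finA us sA; apply/perm_size/uniq_perm => // x.
by apply/idP/idP => [/(in_fset_setP _ finA)/sA|/sA/(in_fset_setP _ finA)].
Qed.

Lemma card_fset_set_bij (T U : choiceType) (A : set T) (B : set U)
    (f : T -> U) :
  finite_set A -> finite_set B -> {in A &, injective f} ->
  (forall x, A x -> B (f x)) -> (forall y, B y -> exists2 x, A x & f x = y) ->
  #|` fset_set A|%fset = #|` fset_set B|%fset.
Proof.
move=> finA finB injf fAB fBA.
rewrite [RHS](card_fset_set_seq (s := map f (fset_set A)) finB) ?size_map //.
- rewrite map_inj_in_uniq // => x y /(in_fset_setP _ finA) Ax.
  by move=> /(in_fset_setP _ finA) Ay; apply: injf; rewrite inE.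
- move=> y; split=> [/mapP[x /(in_fset_setP _ finA)/fAB Bfx ->]//|].
  by move=> /fBA[x /(in_fset_setP _ finA) Ax <-]; apply: map_f.
Qed.

End FsetSet.

Section MonicPolys.
Variables (L : fieldType) (r : nat).
Local Notation A := {mpoly L[r]}.
Implicit Types (f g p x : A) (s o : seq A).

Definition monic f : bool := mleadc f == 1.

Definition monic_irr p : Prop := monic p /\ irreducible_elt p.

Lemma monic_neq0 f : monic f -> f != 0.
Proof. by rewrite -mleadc_eq0 => /eqP->; apply: oner_neq0. Qed.

Lemma mleadc_mul f g : mleadc (f * g) = mleadc f * mleadc g.
Proof.
have [->|f0] := eqVneq f 0; first by rewrite mul0r mleadc0 mul0r.
have [->|g0] := eqVneq g 0; first by rewrite mulr0 mleadc0 mulr0.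
by rewrite mleadM // mleadcM.
Qed.

Lemma monic1 : monic 1.
Proof. by rewrite /monic mleadc1. Qed.

Lemma monicMl f g : monic f -> monic (f * g) = monic g.
Proof. by rewrite /monic mleadc_mul => /eqP->; rewrite mul1r. Qed.

Lemma monic_prod (I : Type) (s : seq I) (P : pred I) (F : I -> A) :
  (forall i, P i -> monic (F i)) -> monic (\prod_(i <- s | P i) F i).
Proof.
move=> mF; elim/big_ind: _ => //; first exact: monic1.
by move=> f g mf mg; rewrite monicMl.
Qed.

Lemma monicX f e : monic f -> monic (f ^+ e).
Proof.
by move=> mf; elim: e => [|e IH]; rewrite ?expr0 ?exprS ?monic1 ?monicMl.
Qed.

(** The total degree; the zero polynomial gets degree 0, but monic polynomials are nonzero. *)
Definition mdegree f : nat := (msize f).-1.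

Lemma mdegree1 : mdegree 1 = 0%N.
Proof. by rewrite /mdegree msize1. Qed.

Lemma msize_monic f : monic f -> msize f = (mdegree f).+1.
Proof. by move=> mf; rewrite /mdegree -mpolySpred // monic_neq0. Qed.

Lemma mdegreeM f g : monic f -> monic g ->
  mdegree (f * g) = (mdegree f + mdegree g)%N.
Proof.
move=> mf mg; rewrite /mdegree msizeM ?monic_neq0 // !msize_monic //.
by rewrite addnS.
Qed.

Lemma mdegreeX f e : monic f -> mdegree (f ^+ e) = (e * mdegree f)%N.
Proof.
move=> mf; elim: e => [|e IH]; first by rewrite expr0 mdegree1.
by rewrite exprS mdegreeM ?monicX // IH mulSn.
Qed.

Lemma mdegree_prod (I : eqType) (s : seq I) (F : I -> A) :
  (forall i, i \in s -> monic (F i)) ->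
  mdegree (\prod_(i <- s) F i) = (\sum_(i <- s) mdegree (F i))%N.
Proof.
elim: s => [|i s IH] mF; first by rewrite !big_nil mdegree1.
have mFs j : j \in s -> monic (F j) by move=> js; rewrite mF // inE js orbT.
rewrite !big_cons mdegreeM ?IH ?mF ?inE ?eqxx //.
by rewrite big_seq; apply: monic_prod.
Qed.

Lemma monic_unit f : monic f -> f \is a GRing.unit -> f = 1.
Proof.
move=> mf; rewrite mpoly_unit_msize => /msize_poly1P[c _ fE].
by move: mf; rewrite fE /monic mleadcC => /eqP->.
Qed.

Lemma monic_irr_mdegree p : monic_irr p -> (0 < mdegree p)%N.
Proof.
case=> mp [_ + _]; rewrite mpoly_unit_msize msize_monic // eqSS.
by rewrite lt0n.
Qed.

Lemma monic_irr_prime p : monic_irr p -> prime_elt p.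
Proof. by case=> _; apply: mpoly_irreducible_prime. Qed.

Lemma monic_irr_divides p q : monic_irr p -> monic_irr q -> divides p q -> p = q.
Proof.
case=> mp [_ pU _] [mq [_ _ qP]] [c qcp].
case: (qP _ _ qcp) => [cU|]; last by move=> pU'; rewrite pU' in pU.
by rewrite qcp (monic_unit _ cU) ?mul1r // -(monicMl c mp) mulrC -qcp.
Qed.

(** Normalize each prime factor to leading coefficient 1; the unit left over is then monic, hence
    1. *)
Lemma monic_factorization f : monic f ->
  exists2 s, forall p, p \in s -> monic_irr p & f = \prod_(p <- s) p.
Proof.
move=> mf; have [u [s [uU sP fE]]] := mpoly_factorial (monic_neq0 mf).
have lead_neq0 p : p \in s -> mleadc p != 0.
  by move=> /sP[p0 _ _]; rewrite mleadc_eq0.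
pose nrm p := (mleadc p)^-1 *: p.
have nrmP p : p \in s -> monic_irr (nrm p).
  move=> ps; have p0 := lead_neq0 p ps; split.
    by rewrite /monic mleadcZE mulVf.
  have := prime_irreducible (sP p ps).
  have cU : ((mleadc p)^-1%:MP : A) \is a GRing.unit.
    by rewrite mpoly_unit_msize msizeC invr_eq0 p0.
  rewrite /nrm -mul_mpolyC => _.
  exact/prime_irreducible/prime_associate/sP.
have : exists v : A, [/\ v \is a GRing.unit & f = v * \prod_(p <- map nrm s) p].
  exists (u * \prod_(p <- s) (mleadc p)%:MP); split.
    rewrite unitrM uU /= big_seq; elim/big_ind: _ => [|x y xU|p ps]; rewrite ?unitr1 //.
      by rewrite unitrM xU.
    by rewrite mpoly_unit_msize msizeC lead_neq0.
  rewrite fE -mulrA big_map -big_split /= [in LHS]big_seq [in RHS]big_seq; congr (_ * _).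
  by apply: eq_bigr => p ps; rewrite mul_mpolyC scalerA divff ?scale1r ?lead_neq0.
case=> v [vU fv].
have mprod : monic (\prod_(p <- map nrm s) p).
  by rewrite big_map big_seq; apply: monic_prod => p /nrmP[].
exists (map nrm s) => [p /mapP[q /nrmP ? ->]//|].
by rewrite fv (monic_unit _ vU) ?mul1r // -(monicMl v mprod) mulrC -fv.
Qed.

Lemma prime_divides_prod (p : A) (I : eqType) (s : seq I) (F : I -> A) :
  prime_elt p -> divides p (\prod_(i <- s) F i) ->
  exists2 i, i \in s & divides p (F i).
Proof.
move=> [p0 pU pP]; elim: s => [|i s IH].
  rewrite big_nil => -[c c1]; case/negP: pU; apply/unitrPr; exists c.
  by rewrite mulrC.
rewrite big_cons => /pP[pi|/IH[j js pj]]; first by exists i; rewrite ?inE ?eqxx.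
by exists j; rewrite // inE js orbT.
Qed.

Lemma prime_divides_exp (p f : A) e : prime_elt p -> divides p (f ^+ e) ->
  divides p f.
Proof.
move=> pP; rewrite -(card_ord e) -prodr_const.
by case/(prime_divides_prod pP).
Qed.

(** Induction on [e]: one factor [p] at a time must come from [f], and is cancelled. *)
Lemma prime_exp_divides (p f g : A) e : prime_elt p -> ~ divides p g ->
  divides (p ^+ e) (f * g) -> divides (p ^+ e) f.
Proof.
move=> [p0 pU pP] npg; elim: e f => [|e IH] f.
  by exists f; rewrite expr0 mulr1.
case=> c fgE; have : divides p (f * g).
  by rewrite fgE exprS; exists (c * p ^+ e); ring.
case/pP=> // -[d fE]; have /IH[c' dE] : divides (p ^+ e) (d * g).
  exists c; apply: (mulfI p0); transitivity (f * g); first by rewrite fE; ring.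
  by rewrite fgE exprS; ring.
by exists c'; rewrite fE dE exprS; ring.
Qed.

(** The multiplicity of [p] can be read off any factorization: no other factor is divisible by [p],
    so a power of [p] dividing the product divides [p ^+ count_mem p s], and cancelling bounds the
    exponent. *)
Lemma divides_exp_prod p s e : monic_irr p ->
  (forall x, x \in s -> monic_irr x) ->
  divides (p ^+ e) (\prod_(x <- s) x) <-> (e <= count_mem p s)%N.
Proof.
move=> pI sI; rewrite (bigID (pred1 p)) /=.
have -> : \prod_(x <- s | x == p) x = p ^+ count_mem p s.
  rewrite (eq_bigr (fun=> p)) => [|x /eqP//].
  by rewrite big_const_seq iter_mulr_1.
split=> [|le_e]; last first.
  by apply: divides_mulr; exists (p ^+ (count_mem p s - e)); rewrite -exprD subnK.
have pP := monic_irr_prime pI; move=> /(prime_exp_divides pP)[].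
  rewrite -big_filter => /(prime_divides_prod pP)[x].
  rewrite mem_filter => /andP[/negP xp /sI xI] /(monic_irr_divides pI xI) px.
  by case: xp; rewrite px.
move=> c; case: leqP => // lt_c; rewrite -(subnKC lt_c) addSn exprS exprD => E.
have p0 : p != 0 by case: pP.
have pU : p \isn't a GRing.unit by case: pP.
case/negP: pU; apply/unitrPr; exists (c * p ^+ (e - (count_mem p s).+1)).
apply: (mulfI (expf_neq0 (count_mem p s) p0)); rewrite mulr1 [RHS]E.
ring.
Qed.

(** Distinct monic irreducibles do not divide one another, so [y ^+ e] divides the cofactor left
    after dividing out the other powers. *)
Lemma divides_prod_exp o e f : uniq o -> (forall x, x \in o -> monic_irr x) ->
  (forall x, x \in o -> divides (x ^+ e) f) -> divides ((\prod_(x <- o) x) ^+ e) f.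
Proof.
elim: o => [|y o IH] /=; first by exists f; rewrite big_nil expr1n mulr1.
case/andP=> yo uo oI od.
have oI' x : x \in o -> monic_irr x by move=> xo; apply: oI; rewrite inE xo orbT.
have [|c fE] := IH uo oI'; first by move=> x xo; apply: od; rewrite inE xo orbT.
have yI : monic_irr y by apply: oI; rewrite inE eqxx.
have := od y; rewrite inE eqxx => /(_ isT); rewrite fE.
move/(prime_exp_divides (monic_irr_prime yI)) => [].
  move/(prime_divides_exp (monic_irr_prime yI)).
  case/(prime_divides_prod (monic_irr_prime yI)) => x xo.
  move/(monic_irr_divides yI (oI' _ xo)) => yx.
  by rewrite yx xo in yo.
by move=> d ->; exists d; rewrite big_cons exprMn mulrA.
Qed.

End MonicPolys.

(** * Polynomials fixed by a field automorphism *)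

Lemma monic_polysP (L : fieldType) (r n : nat) (f : {mpoly L[r]}) :
  monic_polys n f <-> monic f /\ mdegree f = n.
Proof.
rewrite /monic /mdegree; split=> [[-> ->]|[/[dup] mf /eqP f1 <-]] //.
by split=> //; rewrite -mpolySpred // monic_neq0.
Qed.

Lemma irr_polysP (L : fieldType) (r n : nat) (f : {mpoly L[r]}) :
  irr_polys n f <-> monic_irr f /\ mdegree f = n.
Proof. by rewrite /irr_polys /= monic_polysP /monic_irr; tauto. Qed.

Section CoefAction.
Variables (L K : fieldType) (r : nat) (phi : {rmorphism L -> K}).
Implicit Types f : {mpoly L[r]}.

Lemma map_mpoly_inj : injective (map_mpoly phi : {mpoly L[r]} -> {mpoly K[r]}).
Proof.
move=> f g /mpolyP fg; apply/mpolyP => m; apply: (fmorph_inj phi).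
by rewrite -!mcoeff_map_mpoly fg.
Qed.

Lemma msize_map_mpoly f : msize (map_mpoly phi f) = msize f.
Proof. by rewrite !msizeE; apply: perm_big; exact: (msupp_map_mpoly _ (fmorph_inj _)). Qed.

Lemma mlead_map_mpoly f : mlead (map_mpoly phi f) = mlead f.
Proof.
have [->|f0] := eqVneq f 0; first by rewrite raddf0 !mlead0.
have Tf0 : map_mpoly phi f != 0.
  by rewrite -(raddf0 (map_mpoly phi)) (inj_eq map_mpoly_inj).
have supp := perm_mem (msupp_map_mpoly f (fmorph_inj phi)).
apply/le_anti; rewrite !msupp_le_mlead //; first by rewrite supp mlead_supp.
by rewrite -supp mlead_supp.
Qed.

Lemma monic_map_mpoly f : monic (map_mpoly phi f) = monic f.
Proof. by rewrite /monic mlead_map_mpoly mcoeff_map_mpoly fmorph_eq1. Qed.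

Lemma mdegree_map_mpoly f : mdegree (map_mpoly phi f) = mdegree f.
Proof. by rewrite /mdegree msize_map_mpoly. Qed.

End CoefAction.

(** * Orbits of irreducible polynomials and their norms *)

Section FrobeniusAction.
Variables (L : fieldType) (r : nat) (tau : {rmorphism L -> L}).
Hypothesis tau_bij : bijective tau.
Local Notation A := {mpoly L[r]}.
Local Notation T := (map_mpoly tau : A -> A).
Implicit Types (f g p : A) (j n k e : nat).

(** [iter j T f = f] says that the coefficients of [f] lie in the fixed field of the [j]-th iterate
    of [tau]. *)
Definition fixed_monic j n : set A := [set f | monic_polys n f /\ iter j T f = f].

Definition fixed_irr j n : set A := [set p | irr_polys n p /\ iter j T p = p].

(** Cardinalities of [fset_set] are meaningful only for finite sets; the index 0 is left out because
    the zeroth iterate fixes every polynomial. *)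
Hypothesis fixed_monic_finite :
  forall j n, (0 < j)%N -> finite_set (fixed_monic j n).

Definition num_fixed_monic n : nat := #|` fset_set (fixed_monic 1 n)|%fset.

Definition num_fixed_irr j n : nat := #|` fset_set (fixed_irr j n)|%fset.

Lemma fixed_irr_finite j n : (0 < j)%N -> finite_set (fixed_irr j n).
Proof.
move=> j0; apply: sub_finite_set (fixed_monic_finite n j0).
by move=> p [[]].
Qed.

Lemma map_mpoly_bij : bijective T.
Proof.
case: tau_bij => sigma tauK sigmaK.
(* The inverse applies [sigma] to the coefficients; [sigma] is given only as a function, so the sum
   over monomials is written out. *)
exists (fun f => \sum_(m <- msupp f) sigma f@_m *: 'X_[m]) => f.
  rewrite [RHS]mpolyE; under eq_bigr do rewrite mcoeff_map_mpoly tauK.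
  apply: perm_big; exact: (msupp_map_mpoly _ (fmorph_inj _)).
rewrite [RHS]mpolyE raddf_sum; apply: eq_bigr => m _.
by rewrite /= map_mpolyZ map_mpolyX sigmaK.
Qed.

Let T_inj : injective T.
Proof. exact: map_mpoly_inj. Qed.

Let iter_inj i : injective (iter i T).
Proof. by elim: i => // i IH f g /T_inj/IH. Qed.

Lemma iter_monic_irr j p : monic_irr p -> monic_irr (iter j T p).
Proof.
move=> pI; elim: j => //= j [mp ip]; split; first by rewrite monic_map_mpoly.
exact: (rmorph_bij_irreducible map_mpoly_bij).
Qed.

Lemma iter_mdegree j p : mdegree (iter j T p) = mdegree p.
Proof. by elim: j => //= j <-; apply: mdegree_map_mpoly. Qed.

Lemma iter_divides j p e f : T f = f -> divides (p ^+ e) f ->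
  divides (iter j T p ^+ e) f.
Proof.
move=> Tf pf; elim: j => //= j [c fE]; exists (T c).
by rewrite -rmorphXn -rmorphM -fE.
Qed.

(** Pigeonhole: all iterates of [p] divide [f], so they occur in its finite factorization; two of
    them coincide, and iterates of [T] are injective. *)
Lemma divisor_periodic f p : monic f -> T f = f -> monic_irr p -> divides p f ->
  exists2 k, (0 < k)%N & iter k T p = p.
Proof.
move=> mf Tf pI pf; have [s sI fE] := monic_factorization mf.
have in_s i : iter i T p \in s.
  have := @iter_divides i p 1 f Tf; rewrite !expr1 => /(_ pf).
  rewrite {1}fE => /(prime_divides_prod (monic_irr_prime (iter_monic_irr i pI))).
  by case=> x xs /(monic_irr_divides (iter_monic_irr i pI) (sI x xs))->.
pose o := [seq iter i T p | i <- iota 0 (size s).+1].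
have : ~~ uniq o.
  have o_s : {subset o <= s} by move=> x /mapP[i _ ->].
  by apply/negP => /uniq_leq_size/(_ o_s); rewrite size_map size_iota ltnn.
apply: contraNP => none; rewrite map_inj_in_uniq ?iota_uniq // => i j _ _.
wlog ltij : i j / (i < j)%N => [wl|].
  by case: (ltngtP i j) => [/wl|/wl h /esym/h ->|] //; apply.
rewrite -(subnKC (ltnW ltij)) iterD => /iter_inj E; exfalso; apply: none.
by exists (j - i)%N; rewrite ?subn_gt0.
Qed.

(** The exact period, stated through all return times because the counting needs to know which
    iterates fix [p]. *)
Definition period p k : Prop :=
  (0 < k)%N /\ forall j, (iter j T p == p) = (k %| j)%N.

Lemma exists_period p j : (0 < j)%N -> iter j T p = p -> exists k, period p k.
Proof.
move=> j0 jp; have ex : exists k, (0 < k)%N && (iter k T p == p).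
  by exists j; rewrite j0 jp eqxx.
case: (ex_minnP ex) => k /andP[k0 /eqP kp] kmin; exists k; split=> // i.
have mulk c : iter (c * k) T p = p.
  by elim: c => // c IH; rewrite mulSn iterD IH kp.
apply/eqP/idP => [|/dvdnP[c ->]]; last exact: mulk.
rewrite {1}(divn_eq i k) addnC iterD mulk => ip.
rewrite /dvdn -leqn0 leqNgt; apply/negP => i0.
have := kmin (i %% k)%N; rewrite i0 ip eqxx => /(_ isT).
by rewrite leqNgt ltn_mod k0.
Qed.

(** For [k] the period of [p], the product over the orbit of [p]; it acts as a prime of degree
    [k * mdegree p] among the fixed polynomials. *)
Definition orbit_norm p k : A := \prod_(i < k) iter i T p.

Lemma orbit_norm_fixed p k : iter k T p = p -> T (orbit_norm p k) = orbit_norm p k.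
Proof.
case: k => [|k] kp; first by rewrite /orbit_norm big_ord0 rmorph1.
rewrite /orbit_norm rmorph_prod [LHS]big_ord_recr [RHS]big_ord_recl /=.
by rewrite -iterS kp mulrC.
Qed.

Lemma orbit_norm_monic p k : monic_irr p -> monic (orbit_norm p k).
Proof. by move=> pI; apply: monic_prod => i _; case: (iter_monic_irr i pI). Qed.

Lemma mdegree_orbit_norm p k : monic_irr p ->
  mdegree (orbit_norm p k) = (k * mdegree p)%N.
Proof.
move=> pI; rewrite mdegree_prod => [|i _]; last by case: (iter_monic_irr i pI).
rewrite (eq_bigr (fun=> mdegree p)) => [|i _]; last exact: iter_mdegree.
by rewrite sum_nat_const card_ord.
Qed.

(** A fixed [f] divisible by [p ^+ e] is divisible by the same power of every conjugate of [p];
    these are distinct within one period, so the product of their powers divides [f]. *)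
Lemma orbit_norm_divides p k e f : monic_irr p -> period p k -> T f = f ->
  divides (p ^+ e) f <-> divides (orbit_norm p k ^+ e) f.
Proof.
move=> pI [k0 kP] Tf; split=> [pf|]; last first.
  apply: divides_trans; case: k k0 {kP} => // k _.
  by exists (\prod_(i < k) iter i.+1 T p ^+ e); rewrite /orbit_norm big_ord_recl exprMn mulrC prodrXl.
have -> : orbit_norm p k = \prod_(x <- [seq iter i T p | i <- iota 0 k]) x.
  by rewrite big_map /orbit_norm -(big_mkord xpredT (fun i => iter i T p)) /index_iota subn0.
apply: divides_prod_exp => [|x /mapP[i _ ->]|x /mapP[i _ ->]].
- rewrite map_inj_in_uniq ?iota_uniq // => i j.
  rewrite !mem_iota /= !add0n.
  wlog ltij : i j / (i < j)%N => [wl|ltik ltjk].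
    by case: (ltngtP i j) => [/wl h|/wl h ik jk /esym/h ->|] //; apply: h.
  rewrite -(subnKC (ltnW ltij)) iterD => /iter_inj/esym/eqP.
  rewrite kP gtnNdvd ?subn_gt0 //.
  exact: leq_ltn_trans (leq_subr _ _) ltjk.
- exact: iter_monic_irr.
- exact: iter_divides.
Qed.

Lemma in_fixed_monic n f :
  f \in fset_set (fixed_monic 1 n) <-> [/\ monic f, mdegree f = n & T f = f].
Proof.
rewrite in_fset_setP; last exact: fixed_monic_finite.
by rewrite /fixed_monic /= monic_polysP; split=> [[[]]|[]].
Qed.

Lemma in_fixed_irr j n p : (0 < j)%N ->
  p \in fset_set (fixed_irr j n) <->
  [/\ monic_irr p, mdegree p = n & iter j T p = p].
Proof.
move=> j0; rewrite in_fset_setP; last exact: fixed_irr_finite.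
by rewrite /fixed_irr /= irr_polysP; split=> [[[]]|[]].
Qed.

(** Multiplication by the [e]-th power of the orbit norm is a bijection from the fixed monic
    polynomials of the complementary degree onto those divisible by [p ^+ e]. *)
Lemma count_divides_exp p k e n : monic_irr p -> period p k ->
  count (fun f => `[< divides (p ^+ e) f >]) (fset_set (fixed_monic 1 n)) =
  (if (e * (k * mdegree p) <= n)%N
   then num_fixed_monic (n - e * (k * mdegree p)) else 0)%N.
Proof.
move=> pI kP; set c := (e * _)%N; pose N := orbit_norm p k ^+ e.
have mN : monic N by apply/monicX/orbit_norm_monic.
have TN : T N = N.
  by rewrite rmorphXn /= orbit_norm_fixed //; case: kP => _ /(_ k); rewrite dvdnn => /eqP.
have dN : mdegree N = c by rewrite mdegreeX ?orbit_norm_monic // mdegree_orbit_norm.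
have quotient f : monic f -> T f = f -> divides (p ^+ e) f ->
    exists g, [/\ monic g, T g = g, f = N * g & mdegree f = (c + mdegree g)%N].
  move=> mf Tf /(orbit_norm_divides e pI kP Tf)[g]; rewrite mulrC => fE.
  have mg : monic g by rewrite -(monicMl g mN) -fE.
  exists g; split=> //; last by rewrite fE mdegreeM // dN.
  (* The cofactor is fixed too: apply [T] to [f = N * g] and cancel the fixed factor [N]. *)
  by apply: (mulfI (monic_neq0 mN)); rewrite -{1}TN -rmorphM -fE.
case: leqP => [le_cn|lt_nc]; last first.
  apply/eqP; rewrite -leqn0 leqNgt -has_count; apply/hasPn => f.
  move/in_fixed_monic=> [mf df Tf]; apply/asboolP => /(quotient f mf Tf)[g [_ _ _ dfg]].
  by move: lt_nc; rewrite -df dfg ltnNge leq_addr.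
rewrite -size_filter -[RHS](size_map (fun g => N * g)).
apply/perm_size/uniq_perm; first exact/filter_uniq/fset_uniq.
  by rewrite map_inj_uniq ?fset_uniq //; apply/mulfI/monic_neq0.
move=> f; rewrite mem_filter; apply/andP/mapP => [[/asboolP pf /in_fixed_monic[mf df Tf]]|].
  have [g [mg Tg fE dfg]] := quotient f mf Tf pf.
  by exists g => //; apply/in_fixed_monic; rewrite -df dfg addKn.
case=> g /in_fixed_monic[mg dg Tg] ->; split; last first.
  by apply/in_fixed_monic; rewrite monicMl // mdegreeM // dN dg subnKC // rmorphM /= TN Tg.
apply/asboolP/(orbit_norm_divides e pI kP); first by rewrite rmorphM /= TN Tg.
by exists g; rewrite mulrC.
Qed.

End FrobeniusAction.

(** * Rearranging sums of indicators *)

Section IndicatorSums.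

Lemma sum_eq_indicator (I : eqType) (s : seq I) (F : I -> nat) (x : I) :
  uniq s -> (\sum_(i <- s) F i * (i == x) = (x \in s) * F x)%N.
Proof.
elim: s => [|i s IH] /=; first by rewrite big_nil.
case/andP=> is_ us; rewrite big_cons IH // inE eq_sym.
by have [->|] := eqVneq x i; rewrite ?(negPf is_) ?muln1 ?mul1n ?mul0n ?addn0 ?muln0.
Qed.

Lemma sum_count_mem (I : eqType) (s t : seq I) (F : I -> nat) :
  uniq t -> {subset s <= t} ->
  (\sum_(i <- t) F i * count_mem i s = \sum_(x <- s) F x)%N.
Proof.
move=> ut st; transitivity (\sum_(x <- s) \sum_(i <- t) F i * (i == x))%N.
  rewrite exchange_big /=; apply: eq_bigr => i _.
  rewrite -sum1_count big_mkcond /= big_distrr /=.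
  by apply: eq_bigr => x _; rewrite eq_sym; case: eqP.
by apply: eq_big_seq => x xs; rewrite sum_eq_indicator // st // mul1n.
Qed.

(** Used with [c] the multiplicity of an irreducible, which becomes the number of its powers
    dividing a polynomial. *)
Lemma sum_leq_indicator n c :
  (c <= n)%N -> (\sum_(1 <= e < n.+1) (e <= c) = c)%N.
Proof.
move=> le_cn; rewrite (big_cat_nat (n := c.+1)) //=.
rewrite [X in (_ + X)%N]big_nat_cond [X in (_ + X)%N]big1 ?addn0.
  rewrite big_nat_cond (eq_bigr (fun=> 1%N)) => [|e /andP[/andP[_ ec] _]].
    by rewrite -big_nat_cond sum_nat_const_nat subSS subn0 muln1.
  by rewrite -ltnS ec.
by move=> e /andP[/andP[ce _] _]; rewrite leqNgt ce.
Qed.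

(** The substitution [m = e * c] turns a sum over exponents into a sum over degrees. *)
Lemma sum_multiples n c (F : nat -> nat) : (0 < c)%N ->
  (\sum_(1 <= e < n.+1) (if e * c <= n then F (n - e * c) else 0) =
   \sum_(1 <= m < n.+1) (c %| m) * F (n - m))%N.
Proof.
move=> c0; transitivity (\sum_(1 <= e < n.+1) \sum_(1 <= m < n.+1)
    F (n - m)%N * (m == e * c)%N)%N.
  rewrite big_nat [RHS]big_nat; apply: eq_bigr => e /andP[e0 _].
  rewrite sum_eq_indicator ?iota_uniq // mem_index_iota ltnS muln_gt0 c0 e0 /=.
  by case: leqP; rewrite ?mul1n.
rewrite exchange_big big_nat [RHS]big_nat /=; apply: eq_bigr => m /andP[m0 mn].
rewrite -big_distrr /= mulnC; congr (_ * _)%N.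
have [/dvdnP[k mE]|ncm] := boolP (c %| m)%N.
  have k0 : (0 < k)%N by case: k mE => // mE; rewrite mE in m0.
  rewrite (eq_bigr (fun e => 1 * (e == k)))%N => [|e _]; last first.
    by rewrite mE eqn_pmul2r // mul1n eq_sym.
  rewrite sum_eq_indicator ?iota_uniq // mem_index_iota k0 muln1 /=.
  by rewrite (leq_ltn_trans _ mn) // mE leq_pmulr.
rewrite big1 // => e _; case: eqP ncm => // ->.
by rewrite dvdn_mull.
Qed.

End IndicatorSums.

(** * The Euler product over orbits *)

Section EulerProduct.
Variables (L : fieldType) (r : nat) (tau : {rmorphism L -> L}).
Hypothesis tau_bij : bijective tau.
Hypothesis fixed_monic_finite : forall j n, (0 < j)%N ->
  finite_set (fixed_monic tau j n : set {mpoly L[r]}).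
Local Notation A := {mpoly L[r]}.
Local Notation T := (map_mpoly tau : A -> A).
Local Notation P n := (num_fixed_monic r tau n).
Local Notation a j d := (num_fixed_irr r tau j d).

(** A finite list holding every monic irreducible factor of a fixed monic polynomial of degree [n]:
    such a factor has a period at most [n], which divides the factorial. *)
Let Tset n : seq A :=
  undup (flatten [seq (fset_set (fixed_irr tau n`! d) : seq A) | d <- iota 1 n]).

Let mem_Tset n p : p \in Tset n <->
  [/\ monic_irr p, (mdegree p <= n)%N & iter n`! T p = p].
Proof.
rewrite mem_undup; split=> [/flatten_mapP[d]|[pI dp pT]].
  rewrite mem_iota add1n ltnS => /andP[_ dn].
  by case/(in_fixed_irr fixed_monic_finite _ _ (fact_gt0 n)) => ? -> ?; split.
apply/flatten_mapP; exists (mdegree p).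
  by rewrite mem_iota add1n ltnS dp monic_irr_mdegree.
exact/(in_fixed_irr fixed_monic_finite _ _ (fact_gt0 n)).
Qed.

Let Tset_period n p : p \in Tset n -> exists k, period tau p k.
Proof.
move=> /mem_Tset[_ _ pT]; apply: exists_period pT; exact: fact_gt0.
Qed.

(** The degree of [f] is the sum of the degrees of its irreducible factors with multiplicity, and
    the multiplicity of [p] is the number of powers [p ^+ e] dividing [f]. *)
Let sum_valuation n f : monic f -> mdegree f = n -> T f = f ->
  (\sum_(p <- Tset n) mdegree p *
     \sum_(1 <= e < n.+1) `[< divides (p ^+ e) f >] = n)%N.
Proof.
move=> mf df Tf; have [s sI fE] := monic_factorization mf.
have s_sub : {subset s <= Tset n}.
  move=> p ps; have pI := sI p ps.
  have pf : divides p f.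
    rewrite -[p]expr1 fE; apply/divides_exp_prod => //.
    by rewrite -has_count; apply/hasP; exists p => /=.
  have [j j0 jp] := divisor_periodic tau_bij mf Tf pI pf.
  have [k kP] := exists_period j0 jp.
  have [g fE'] : divides (orbit_norm tau p k) f.
    rewrite -[orbit_norm _ _ _]expr1.
    by apply/(orbit_norm_divides tau_bij 1 pI kP Tf); rewrite expr1.
  have mN := orbit_norm_monic tau_bij k pI.
  have mg : monic g by rewrite -(monicMl g mN) mulrC -fE'.
  (* The orbit norm divides [f] and has degree [k * mdegree p], so the period [k] is at most [n]. *)
  have le_kd : (k * mdegree p <= n)%N.
    by rewrite -df fE' mulrC mdegreeM // mdegree_orbit_norm // leq_addr.
  case: kP => k0 kP; apply/mem_Tset; split=> //.
    exact: leq_trans (leq_pmull _ k0) le_kd.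
  apply/eqP; rewrite kP dvdn_fact // k0 (leq_trans _ le_kd) //.
  by rewrite leq_pmulr // monic_irr_mdegree.
have dE : n = (\sum_(p <- s) mdegree p)%N.
  by rewrite -df fE mdegree_prod // => p /sI[].
rewrite [RHS]dE -(sum_count_mem _ (undup_uniq _) s_sub).
apply: eq_big_seq => p /mem_Tset[pI _ _]; congr (_ * _)%N.
rewrite -[RHS](@sum_leq_indicator n).
  apply: eq_bigr => e _; congr nat_of_bool; rewrite fE.
  by apply/asboolP/idP => /(divides_exp_prod e pI sI).
(* Each occurrence of [p] in [s] contributes at least 1 to the degree, so the multiplicity is at
   most [n]. *)
rewrite -sum1_count [X in (_ <= X)%N]dE [X in (_ <= X)%N](bigID (pred1 p)) /=.
apply: leq_trans (leq_addr _ _); apply: leq_sum => x /eqP->.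
exact: monic_irr_mdegree.
Qed.

(** As [j] divides the factorial of [n], irreducibles of degree at most [n] fixed by the [j]-th
    iterate lie in [Tset n]. *)
Let num_fixed_irrE n j d : (0 < j <= n)%N -> (d <= n)%N ->
  a j d = (\sum_(p <- Tset n) ((mdegree p == d) && (iter j T p == p)))%N.
Proof.
case/andP=> j0 jn dn; rewrite /num_fixed_irr.
rewrite (card_fset_set_seq
  (s := [seq p <- Tset n | (mdegree p == d) && (iter j T p == p)])).
- by rewrite size_filter -sum1_count big_mkcond; apply: eq_bigr => p _; case: ifP.
- exact: fixed_irr_finite.
- exact/filter_uniq/undup_uniq.
move=> p; rewrite -(in_fset_setP _ (fixed_irr_finite fixed_monic_finite d j0)).
rewrite in_fixed_irr // mem_filter.
split=> [/andP[/andP[/eqP dp /eqP jp] /mem_Tset[pI _ _]]|[pI dp jp]]; first by [].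
rewrite dp jp !eqxx; apply/mem_Tset; rewrite dp; split=> //.
have /dvdnP[c ->] : (j %| n`!)%N by rewrite dvdn_fact // j0.
by elim: c => // c IH; rewrite mulSn iterD IH jp.
Qed.

(* The logarithmic derivative of the Euler product over the [tau]-orbits of
   monic irreducible polynomials, an orbit of [k] polynomials of degree [d]
   counting as one prime of degree [k * d]. *)
Theorem fixed_monic_recurrence n :
  (n * P n = \sum_(1 <= m < n.+1)
     (\sum_(d <- divisors m) d * a (m %/ d) d) * P (n - m))%N.
Proof.
(* Equivalent to: the orbit degree of [p], its period times [mdegree p], divides [m]. *)
pose fixes m p := (mdegree p %| m)%N && (iter (m %/ mdegree p) T p == p).
transitivity (\sum_(p <- Tset n) mdegree p *
    \sum_(1 <= m < n.+1) fixes m p * P (n - m))%N.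
  (* Double counting of the pairs of [f] and a power [p ^+ e] dividing it: by [sum_valuation] each
     fixed monic [f] of degree [n] contributes [n]. *)
  transitivity (\sum_(f <- fset_set (fixed_monic tau 1 n))
      \sum_(p <- Tset n) mdegree p *
        \sum_(1 <= e < n.+1) `[< divides (p ^+ e) f >])%N.
    rewrite (eq_big_seq (fun=> n)) => [|f /(in_fixed_monic fixed_monic_finite)[]].
      by rewrite big_const_seq count_predT iter_addn addn0.
    exact: sum_valuation.
  rewrite exchange_big /=; apply: eq_big_seq => p pT.
  have [pI _ _] := (mem_Tset n p).1 pT; have [k kP] := Tset_period pT.
  have [k0 kE] := kP; have d0 := monic_irr_mdegree pI.
  rewrite -big_distrr /= exchange_big /=; congr (_ * _)%N.
  rewrite (eq_bigr (fun e => if (e * (k * mdegree p) <= n)%N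
      then P (n - e * (k * mdegree p)) else 0)%N) => [|e _].
    rewrite sum_multiples ?muln_gt0 ?k0 //; apply: eq_bigr => m _.
    congr (_ * _)%N; rewrite /fixes kE; congr nat_of_bool.
    have [/dvdnP[c ->]|nd] := boolP (mdegree p %| m)%N.
      by rewrite mulnK // dvdn_pmul2r.
    by apply: contraNF nd; apply: dvdn_trans; apply: dvdn_mull.
  rewrite -(count_divides_exp tau_bij fixed_monic_finite) // -sum1_count.
  by rewrite [RHS]big_mkcond; apply: eq_bigr => f _; case: ifP.
under eq_bigr do rewrite big_distrr /=.
rewrite exchange_big /= big_nat [RHS]big_nat; apply: eq_bigr => m /andP[m0 mn].
under eq_bigr do rewrite mulnA.
rewrite -big_distrl /=; congr (_ * _)%N.
(* Group the irreducibles by their degree [d]. *)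
transitivity (\sum_(d <- divisors m) \sum_(p <- Tset n)
    d * (iter (m %/ d) T p == p) * (d == mdegree p))%N.
  rewrite exchange_big; apply: eq_bigr => p _.
  rewrite sum_eq_indicator ?divisors_uniq // -dvdn_divisors // /fixes.
  by rewrite mulnCA mulnb.
apply: eq_big_seq => d; rewrite -dvdn_divisors // => dm.
have d0 := dvdn_gt0 m0 dm; have dlem := dvdn_leq m0 dm.
rewrite (@num_fixed_irrE n) ?big_distrr /=.
- by apply: eq_bigr => p _; rewrite -mulnA mulnb andbC [d == _]eq_sym.
- by rewrite divn_gt0 // dlem (leq_trans (leq_div _ _)).
- exact: leq_trans dlem _.
Qed.

End EulerProduct.

(** * Counting monic polynomials *)

(** Induction on [b] by Pascal's rule: raising the bound by one adds the monomials of degree [b],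
    enumerated by [basis]. *)
Lemma card_bmultinom n b : #|{: 'X_{1..n.+1 < b}}| = 'C(b + n, n.+1).
Proof.
elim: b => [|b IH].
  by rewrite add0n bin_small //; apply: eq_card0 => -[m].
pose B := [seq s2m t | t : b.-tuple 'I_n.+1 <- enum (basis n.+1 b)].
pose S k := [seq val m | m : 'X_{1..n.+1 < k} <- enum {: 'X_{1..n.+1 < k}}].
have mem_S k m : (m \in S k) = (mdeg m < k)%N.
  apply/mapP/idP => [[m' _ ->]|mk]; first exact: bmdeg.
  by exists (BMultinom mk); rewrite ?mem_enum.
have uniq_S k : uniq (S k) by rewrite map_inj_uniq ?enum_uniq //; apply: val_inj.
have size_S k : size (S k) = #|{: 'X_{1..n.+1 < k}}| by rewrite size_map cardE.
have : perm_eq (S b.+1) (S b ++ B).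
  apply: uniq_perm => // [|m].
    rewrite cat_uniq uniq_S uniq_basis andbT; apply/hasPn => m.
    by rewrite -basis_cover mem_S => /eqP->; rewrite ltnn.
  by rewrite mem_cat !mem_S -basis_cover ltnS leq_eqVlt orbC.
move/perm_size; rewrite size_cat size_basis !size_S IH => ->.
by rewrite addSn binS -[in X in (_ + X)%N](bin_sub (leq_addr n b)) addKn.
Qed.

Section CoefficientsInSubfield.
Variables (L : fieldType) (r : nat) (C : {fset L}).
Local Notation A := {mpoly L[r]}.
(** [C] stands for a finite fixed field; closure under products and inverses is what rescaling by a
    leading coefficient uses. *)
Hypotheses (C0 : 0 \in C) (CM : {in C &, forall x y, x * y \in C}).
Hypothesis CV : {in C, forall x, x^-1 \in C}.

Definition has_coefs_in (f : A) : Prop := forall m, f@_m \in C.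

Let bounded n : seq A :=
  [seq \sum_(m : 'X_{1..r < n}) val (g m) *: 'X_[m]
     | g : {ffun 'X_{1..r < n} -> C} <- enum {: {ffun 'X_{1..r < n} -> C}}].

Let mcoeff_bounded n (g : {ffun 'X_{1..r < n} -> C}) k :
  (\sum_(m : 'X_{1..r < n}) val (g m) *: 'X_[m])@_k =
  if insub k is Some m then val (g m) else 0.
Proof.
rewrite raddf_sum /=; under eq_bigr do rewrite mcoeffZ mcoeffX.
case: insubP => [m _ mk|nk].
  rewrite (bigD1 m) //= -mk eqxx mulr1 big1 ?addr0 // => m' /negPf m'm.
  by rewrite -[_ == _]/(m' == m) m'm mulr0.
rewrite big1 // => m _; case: eqP => [mk|]; last by rewrite mulr0.
by rewrite -mk bmdeg in nk.
Qed.

Let mem_bounded n f : f \in bounded n <-> (msize f <= n)%N /\ has_coefs_in f.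
Proof.
split=> [/mapP[g _ ->]|[fn fC]].
  split=> [|k]; last first.
    by rewrite mcoeff_bounded; case: insubP => [m _ _|//]; apply: valP.
  rewrite msizeE; apply/bigmax_leqP_seq => k kg _.
  move: kg; rewrite mcoeff_msupp mcoeff_bounded.
  by case: insubP => [m -> //|]; rewrite eqxx.
apply/mapP; exists [ffun m : 'X_{1..r < n} => [` fC m]%fset].
  by rewrite mem_enum.
by rewrite {1}(mpolywE fn); apply: eq_bigr => m _; rewrite ffunE.
Qed.

Let uniq_bounded n : uniq (bounded n).
Proof.
rewrite map_inj_uniq ?enum_uniq // => g h gh; apply/ffunP => m.
apply: val_inj; have := congr1 (fun f : A => f@_m) gh.
by rewrite /= !mcoeff_bounded valK.
Qed.

Let size_bounded n : size (bounded n) = (#|` C| ^ #|{: 'X_{1..r < n}}|)%N.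
Proof. by rewrite size_map -cardE card_ffun cardfE. Qed.

Definition monic_coefs_in n : set A := [set f | monic_polys n f /\ has_coefs_in f].

Let monics n : seq A := [seq f <- bounded n.+1 | monic f & mdegree f == n].

Let mem_monics n f : f \in monics n <-> monic_coefs_in n f.
Proof.
rewrite mem_filter /monic_coefs_in /= monic_polysP.
split=> [/andP[/andP[mf /eqP df] /mem_bounded[]]|[[mf df] fC]] //.
by rewrite mf df eqxx; apply/mem_bounded; rewrite msize_monic // df.
Qed.

Lemma finite_monic_coefs_in n : finite_set (monic_coefs_in n).
Proof.
apply/(@finite_seqP A); exists (monics n); apply/seteqP.
by split=> f; rewrite /= mem_monics.
Qed.

(** A polynomial of [msize] at most [n.+1] either has [msize] at most [n] or is uniquely a nonzero
    scalar times a monic polynomial of degree [n]. *)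
Lemma card_monic_coefs_in n :
  ((#|` C|.-1) * #|` fset_set (monic_coefs_in n)|%fset +
    #|` C| ^ #|{: 'X_{1..r < n}}| = #|` C| ^ #|{: 'X_{1..r < n.+1}}|)%N.
Proof.
have -> : #|` fset_set (monic_coefs_in n)|%fset = size (monics n).
  apply: card_fset_set_seq; first exact: finite_monic_coefs_in.
    exact/filter_uniq/uniq_bounded.
  exact: mem_monics.
rewrite -!size_bounded; pose C' := rem 0 (C : seq L).
have memC' c : (c \in C') = (c != 0) && (c \in C).
  by rewrite mem_rem_uniq ?fset_uniq // inE.
have -> : #|` C|.-1 = size C' by rewrite size_rem.
rewrite addnC -(size_allpairs (fun c f => c *: f)) -size_cat.
apply/perm_size; rewrite perm_sym; apply: uniq_perm => //.
  rewrite cat_uniq uniq_bounded /=; apply/andP; split.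
    apply/hasPn => _ /allpairsP[[c f] /= [cC' fM ->]].
    move: cC'; rewrite memC' => /andP[c0 _].
    apply/negP => /mem_bounded[]; rewrite msizeZ //.
    move/mem_monics: fM => [/monic_polysP[mf df] _].
    by rewrite msize_monic // df ltnn.
  apply: allpairs_uniq; [exact/rem_uniq/fset_uniq|exact/filter_uniq/uniq_bounded|].
  move=> _ _ /allpairsP[[c f] /= [cC fM ->]] /allpairsP[[d g] /= [dC gM ->]] /= E.
  move/mem_monics: fM => [/monic_polysP[/eqP mf _] _].
  move/mem_monics: gM => [/monic_polysP[/eqP mg _] _].
  have cd : c = d.
    by have := congr1 (fun h : A => mleadc h) E; rewrite !mleadcZE mf mg !mulr1.
  move: cC E; rewrite memC' cd => /andP[d0 _] E; congr (_, _).
  by apply: (scalerI d0).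
move=> f; rewrite mem_cat; apply/idP/orP => [/mem_bounded[szf fC]|].
  move: szf; rewrite leq_eqVlt ltnS => /predU1P[szf|szf]; [right|left]; last first.
    exact/mem_bounded.
  have f0 : f != 0 by apply: contra_eq_neq szf => ->; rewrite msize0.
  have c0 : mleadc f != 0 by rewrite mleadc_eq0.
  apply/allpairsP; exists (mleadc f, (mleadc f)^-1 *: f) => /=; split.
  - by rewrite memC' c0 fC.
  - apply/mem_monics; split; last by move=> m; rewrite mcoeffZ CM // CV.
    apply/monic_polysP; rewrite /monic /mdegree mleadcZE mulVf ?eqxx //.
    by rewrite msizeZ ?invr_eq0 // szf.
  - by rewrite scalerA divff // scale1r.
case=> [/mem_bounded[szf fC]|/allpairsP[[c g] /= [cC gM ->]]].
  by apply/mem_bounded; split=> //; apply: leq_trans szf _.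
move: cC; rewrite memC' => /andP[c0 cC].
move/mem_monics: gM => [/monic_polysP[mg dg] gC].
apply/mem_bounded; rewrite msizeZ // msize_monic // dg.
by split=> // m; rewrite mcoeffZ CM.
Qed.

End CoefficientsInSubfield.

Lemma num_monicE (r m Q N : nat) : (0 < r)%N -> (1 < Q)%N ->
  ((Q.-1) * N + Q ^ #|{: 'X_{1..r < m}}| = Q ^ #|{: 'X_{1..r < m.+1}}|)%N ->
  N%:R = num_monic r m Q.
Proof.
case: r => // r _ Q1; rewrite !card_bmultinom /num_monic.
have Q0 : (0 < Q)%N by apply: ltnW.
have -> : (r.+1 - 1 + m)%N = (m + r)%N by rewrite subn1 addnC.
have -> : (r.+1 + m)%N = (m.+1 + r)%N by rewrite addSn addnC -addSn.
rewrite !subn1 /= addSn binS.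
(* [a] and [b] count the monomials of degree below [m] and of degree [m]; the hypothesis reads
   [(Q - 1) * N + Q ^ a = Q ^ (a + b)]. *)
set a := 'C(_, r.+1); set b := 'C(_, r) => /(congr1 (fun k => k%:R : rat)).
have b0 : (0 < b)%N by rewrite bin_gt0 leq_addl.
rewrite natrD natrM -subn1 natrB // !natrX => E.
have q0 : Q%:R != 0 :> rat by rewrite pnatr_eq0 -lt0n.
have q1 : Q%:R - 1 != 0 :> rat by rewrite subr_eq0 pnatr_eq1 gtn_eqF.
have qb : Q%:R ^+ b != 0 :> rat by rewrite expf_neq0.
apply: (mulfI q1); rewrite -(addrK (Q%:R ^+ a) ((Q%:R - 1) * N%:R)) E.
have -> : ((a + b).-1 = a + b.-1)%N by rewrite -!subn1 addnBA.
have bE : Q%:R ^+ b = Q%:R * Q%:R ^+ b.-1 :> rat by rewrite -exprS prednK.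
rewrite !exprD bE; set x := Q%:R ^+ a; set y := Q%:R ^+ b.-1 in bE *.
have y0 : y != 0 by rewrite expf_neq0.
by field; rewrite y0 q0 q1.
Qed.

(** * Moebius inversion and logarithms *)

Section DivisorSums.
Implicit Types (d e m n s : nat) (V : nmodType).

Lemma divn_dvd_gt0 n d : (0 < n)%N -> (d %| n)%N -> (0 < n %/ d)%N.
Proof. by move=> n0 dn; rewrite divn_gt0 ?(dvdn_gt0 n0) // dvdn_leq. Qed.

Lemma perm_divisors_multiples n e : (0 < n)%N -> (e %| n)%N ->
  perm_eq [seq d <- divisors n | (e %| d)%N] [seq (e * u)%N | u <- divisors (n %/ e)].
Proof.
move=> n0 en; have e0 := dvdn_gt0 n0 en.
have ne0 : (0 < n %/ e)%N by apply: divn_dvd_gt0.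
apply: uniq_perm; first exact/filter_uniq/divisors_uniq.
  rewrite map_inj_uniq ?divisors_uniq // => u v /eqP.
  by rewrite eqn_pmul2l // => /eqP.
move=> d; rewrite mem_filter -dvdn_divisors //; apply/andP/mapP.
  case=> /dvdnP[u ->] dn; exists u; last by rewrite mulnC.
  by rewrite -dvdn_divisors // dvdn_divRL.
by case=> u; rewrite -dvdn_divisors // dvdn_divRL // mulnC => un ->; rewrite dvdn_mulr.
Qed.

Lemma big_divisors_dvdn V n e (F : nat -> V) : (0 < n)%N -> (e %| n)%N ->
  \sum_(d <- divisors n | (e %| d)%N) F d =
  \sum_(u <- divisors (n %/ e)) F (e * u)%N.
Proof.
by move=> n0 en; rewrite -big_filter (perm_big _ (perm_divisors_multiples n0 en)) big_map.
Qed.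

Lemma big_divisors_rev V n (F : nat -> V) : (0 < n)%N ->
  \sum_(d <- divisors n) F (n %/ d)%N = \sum_(d <- divisors n) F d.
Proof.
move=> n0; rewrite -(big_map (fun d => n %/ d)%N xpredT F); apply: perm_big.
have divK d : (d %| n)%N -> (n %/ (n %/ d))%N = d.
  by move=> dn; rewrite divnA // mulKn.
apply: uniq_perm; rewrite ?divisors_uniq //.
  rewrite map_inj_in_uniq ?divisors_uniq // => d e.
  by rewrite -!dvdn_divisors // => /divK {2}<- /divK {2}<- ->.
move=> d; rewrite -dvdn_divisors //; apply/mapP/idP.
  by case=> e; rewrite -dvdn_divisors // => en ->; apply: dvdn_div.
by move=> dn; exists (n %/ d)%N; rewrite ?divK // -dvdn_divisors ?dvdn_div.
Qed.

Lemma big_divisors_nested V n (F : nat -> nat -> V) : (0 < n)%N ->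
  \sum_(d <- divisors n) \sum_(e <- divisors d) F d e =
  \sum_(e <- divisors n) \sum_(u <- divisors (n %/ e)) F (e * u)%N e.
Proof.
move=> n0; transitivity
    (\sum_(d <- divisors n) \sum_(e <- divisors n | (e %| d)%N) F d e).
  apply: eq_big_seq => d; rewrite -dvdn_divisors // => dn.
  have d0 := dvdn_gt0 n0 dn; rewrite -[RHS]big_filter; apply: perm_big.
  apply: uniq_perm => [||e]; rewrite ?filter_uniq ?divisors_uniq //.
  rewrite mem_filter -!dvdn_divisors //; apply/idP/andP => [ed|[]//].
  by split=> //; apply: dvdn_trans dn.
rewrite (exchange_big_dep predT) //=; apply: eq_big_seq => e.
by rewrite -dvdn_divisors // => en; rewrite big_divisors_dvdn.
Qed.

(** Both sides range over the pairs with [d * e] dividing [n]. *)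
Lemma big_divisors_exchange V n (F : nat -> nat -> V) : (0 < n)%N ->
  \sum_(d <- divisors n) \sum_(e <- divisors (n %/ d)) F d e =
  \sum_(e <- divisors n) \sum_(d <- divisors (n %/ e)) F d e.
Proof.
move=> n0; have step (G : nat -> nat -> V) :
    \sum_(d <- divisors n) \sum_(e <- divisors (n %/ d)) G d e =
    \sum_(d <- divisors n) \sum_(e <- divisors n | (d * e %| n)%N) G d e.
  apply: eq_big_seq => d; rewrite -dvdn_divisors // => dn.
  have d0 := dvdn_gt0 n0 dn.
  rewrite -[RHS]big_filter; apply: perm_big.
  apply: uniq_perm => [||e]; rewrite ?filter_uniq ?divisors_uniq //.
  have nd0 : (0 < n %/ d)%N by apply: divn_dvd_gt0.
  rewrite mem_filter -(dvdn_divisors _ nd0) -(dvdn_divisors _ n0) dvdn_divRL //.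
  rewrite [(e * d)%N]mulnC; apply/idP/andP => [den|[]//]; split=> //.
  by apply: dvdn_trans den; apply: dvdn_mull.
rewrite step (exchange_big_dep xpredT) //= (step (fun e d => F d e)).
by apply: eq_bigr => e _; apply: eq_bigl => d; rewrite mulnC.
Qed.

End DivisorSums.

(** * The Moebius function *)

Section Mobius.
Implicit Types (d m n p : nat).

Lemma perm_primes_mul p d : prime p -> (0 < d)%N -> ~~ (p %| d)%N ->
  perm_eq (primes (p * d)) (p :: primes d).
Proof.
move=> pr d0 npd; apply: uniq_perm; rewrite ?primes_uniq //.
  by rewrite /= primes_uniq mem_primes (negPf npd) !andbF.
by move=> q; rewrite primesM ?(prime_gt0 pr) // primes_prime // !inE.
Qed.

Lemma mobiusM_prime p d : prime p -> (0 < d)%N -> ~~ (p %| d)%N ->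
  mobius (p * d) = - mobius d.
Proof.
move=> pr d0 npd; have perm := perm_primes_mul pr d0 npd.
have logE q : logn q (p * d) = ((q == p) + logn q d)%N.
  by rewrite lognM ?(prime_gt0 pr) // logn_prime.
rewrite /mobius (perm_all _ perm) (perm_size perm) /= logE eqxx.
have -> : logn p d = 0%N by apply/eqP; rewrite -leqn0 leqNgt logn_gt0 mem_primes (negPf npd) !andbF.
rewrite addn0 eqxx /= exprS mulN1r.
rewrite (@eq_in_all _ _ (fun q => logn q d == 1%N)) => [|q qd].
  by case: ifP; rewrite ?oppr0.
rewrite logE; have [qp|//] := eqVneq q p; move: qd.
by rewrite qp mem_primes (negPf npd) !andbF.
Qed.

Lemma mobius_square p d : prime p -> (0 < d)%N -> (p %| d)%N ->
  mobius (p * d) = 0.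
Proof.
move=> pr d0 pd; rewrite /mobius; case: allP => // /(_ p).
rewrite mem_primes pr muln_gt0 (prime_gt0 pr) d0 dvdn_mulr // => /(_ isT).
rewrite lognM ?(prime_gt0 pr) // logn_prime // eqxx.
by rewrite eqn_add2l eqn0Ngt logn_gt0 mem_primes pr d0 pd.
Qed.

(** For [n > 1] take the least prime [p] of [n]. Multiples of [p * p] contribute 0, and each
    remaining divisor [d] prime to [p] cancels against [p * d]. *)
Lemma sum_mobius n : (0 < n)%N ->
  \sum_(d <- divisors n) mobius d = (n == 1%N)%:R.
Proof.
move=> n0; have [->|n1] := eqVneq n 1%N; first by rewrite big_seq1.
have pr : prime (pdiv n) by rewrite pdiv_prime // ltn_neqAle eq_sym n1.
set p := pdiv n in pr *; have p0 := prime_gt0 pr.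
have pn : (p %| n)%N := pdiv_dvd n.
have np0 : (0 < n %/ p)%N by apply: divn_dvd_gt0.
rewrite (bigID (fun d => p %| d)%N) /= big_divisors_dvdn //.
rewrite (bigID (fun d => p %| d)%N) /= [X in X + _ + _]big1_seq ?add0r; last first.
  move=> d /andP[pd]; rewrite -dvdn_divisors // => dn.
  by rewrite mobius_square // (dvdn_gt0 _ dn).
rewrite -[X in X + _]big_filter -[X in _ + X]big_filter.
have -> : \sum_(d <- [seq d <- divisors n | ~~ (p %| d)%N]) mobius d =
          \sum_(d <- [seq d <- divisors (n %/ p) | ~~ (p %| d)%N]) mobius d.
  apply/perm_big/uniq_perm; rewrite ?filter_uniq ?divisors_uniq // => d.
  rewrite !mem_filter -!dvdn_divisors //; case: (boolP (p %| d)%N) => //= npd.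
  rewrite -{1}(divnK pn) Gauss_dvdl // coprime_sym prime_coprime //.
rewrite -big_split big1_seq // => d; rewrite mem_filter -dvdn_divisors //=.
case/andP=> npd dn.
by rewrite mobiusM_prime ?addNr // (dvdn_gt0 _ dn).
Qed.

End Mobius.

(** * Compositions and the coefficients of a logarithm *)

Section Compositions.
Variable P : nat -> rat.

Lemma perm_compositions_cons l k :
  perm_eq [seq j <- compositions k | size j == l.+1]
    [seq a :: j | a <- iota 1 k, j <- [seq j <- compositions (k - a) | size j == l]].
Proof.
apply: uniq_perm; first exact/filter_uniq/uniq_compositions.
  apply: allpairs_uniq_dep => [|a _|]; first exact: iota_uniq.
    exact/filter_uniq/uniq_compositions.
  by move=> [a j] [b j'] _ _ /= [-> ->].
move=> j; apply/idP/allpairsPdep; rewrite mem_filter mem_compositions.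
  case: j => [|a j]; rewrite ?andbF //= eqSS inE negb_or.
  case/and3P=> sz /andP[a0 j0] /eqP <-; exists a, j; split=> //.
    by rewrite mem_iota lt0n eq_sym a0 add1n ltnS leq_addr.
  by rewrite mem_filter sz mem_compositions j0 addKn eqxx.
case=> a [j' [+ + ->]]; rewrite mem_iota mem_filter mem_compositions add1n ltnS.
case/andP=> a0 ak /and3P[/eqP szj j0 /eqP sj].
by rewrite /= szj eqxx inE negb_or j0 eq_sym -lt0n a0 /= sj subnKC ?eqxx.
Qed.

(** The generating series of [P] without its constant term, truncated after degree [N]. *)
Let u N : {poly rat} := \poly_(i < N.+1) (if i == 0%N then 0 else P i).

(** Expanding the power picks one positive part from each factor; the induction splits off the first
    part. *)
Let coef_uX N l k : (k <= N)%N ->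
  (u N ^+ l)`_k =
  \sum_(j <- compositions k | size j == l) \prod_(a <- j) P a.
Proof.
elim: l k => [|l IH] k kN.
  rewrite expr0 coef1; have [->|k0] := eqVneq k 0%N.
    rewrite -big_filter.
    suff -> : [seq j <- compositions 0 | size j == 0%N] = [:: [::]].
      by rewrite big_seq1 big_nil.
    apply: perm_small_eq => //.
    apply: uniq_perm => [||j]; [exact/filter_uniq/uniq_compositions|by []|].
    by rewrite mem_filter mem_compositions inE; case: j.
  rewrite big_seq_cond big1 // => j; rewrite mem_compositions.
  case/andP=> /andP[_ /eqP sj] /eqP/size0nil j0.
  by rewrite -sj j0 in k0.
rewrite -big_filter (perm_big _ (perm_compositions_cons l k)) big_allpairs_dep /=.
rewrite exprS coefM big_ord_recl coef_poly /= mul0r add0r.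
have -> : iota 1 k = index_iota 1 k.+1 by rewrite /index_iota subn1.
rewrite big_add1 /= big_mkord.
apply: eq_bigr => i _; rewrite coef_poly /= /bump leq0n add1n ltnS.
rewrite (leq_trans (ltn_ord i) kN) IH ?(leq_trans (leq_subr _ _) kN) //.
rewrite big_filter big_distrr /=; apply: eq_bigr => j _.
by rewrite big_cons.
Qed.

Let coef_uX_small N l k : (k < l)%N -> (k <= N)%N -> (u N ^+ l)`_k = 0.
Proof.
move=> kl kN; rewrite coef_uX // big_seq_cond big1 // => j.
rewrite mem_compositions => /andP[/andP[j0 /eqP sj] /eqP szj].
suff : (size j <= sumn j)%N by rewrite szj sj leqNgt kl.
elim: j j0 {sj szj} => //= a j IH; rewrite inE negb_or => /andP[a0 /IH].
by rewrite -add1n; apply: leq_add; rewrite lt0n eq_sym.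
Qed.

(* The coefficients of [log (\sum_n P n * t ^ n)] when [P 0 = 1]. *)
Definition log_coef n : rat :=
  - \sum_(j <- compositions n) (-1) ^+ size j / (size j)%:R * \prod_(a <- j) P a.

(** The series of [log (1 + u N)], cut after the [N]-th power. *)
Let log_poly N : {poly rat} :=
  \sum_(1 <= l < N.+1) ((-1) ^+ l.-1 / l%:R) *: u N ^+ l.

(** A composition of [k <= N] has at most [N] parts, so the cut does not affect coefficient [k]. *)
Let coef_log_poly N k : (0 < k <= N)%N -> (log_poly N)`_k = log_coef k.
Proof.
case/andP=> k0 kN; rewrite coef_sum /log_coef.
have size_comp j : j \in compositions k -> (0 < size j < N.+1)%N.
  rewrite mem_compositions => /andP[j0 /eqP sj].
  have : (size j <= sumn j)%N.
    elim: j j0 {sj} => //= a j IH; rewrite inE negb_or => /andP[a0 /IH].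
    by rewrite -add1n; apply: leq_add; rewrite lt0n eq_sym.
  rewrite sj ltnS => /leq_trans-> //; rewrite andbT.
  by case: j sj {j0} => // k0'; rewrite -k0' in k0.
transitivity (\sum_(1 <= l < N.+1) \sum_(j <- compositions k | size j == l)
   - ((-1) ^+ size j / (size j)%:R * \prod_(a <- j) P a)).
  rewrite big_nat [RHS]big_nat; apply: eq_bigr => l /andP[l0 _].
  rewrite coefZ coef_uX // big_distrr /=; apply: eq_bigr => j /eqP ->.
  by case: l l0 => //= l _; rewrite exprS; ring.
rewrite (exchange_big_dep xpredT) //= -sumrN; apply: eq_big_seq => j jk.
rewrite -big_filter.
have -> : [seq l <- index_iota 1 N.+1 | size j == l] = [:: size j]; last by rewrite big_seq1.
apply: perm_small_eq => //; apply: uniq_perm; rewrite ?filter_uniq ?iota_uniq // => l.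
rewrite mem_filter mem_index_iota inE eq_sym.
by case: eqP => // ->; rewrite size_comp.
Qed.

(* Compare coefficients in [(1 + u) * log (1 + u)^`() = u^`()]. *)
Lemma log_coef_recurrence n : P 0 = 1 ->
  n%:R * P n = \sum_(1 <= m < n.+1) (m%:R * log_coef m) * P (n - m)%N.
Proof.
case: n => [|n] P0; first by rewrite mul0r big_geq.
set v := u n.+1.
have signC k : (-1) ^+ k = ((-1) ^+ k)%:P :> {poly rat}.
  by rewrite rmorphXn rmorphN1.
(* Differentiating the truncated logarithm gives a truncated geometric series in [- v]. *)
have dlog : (log_poly n.+1)^`() = v^`() * \sum_(l < n.+1) (- v) ^+ l.
  rewrite /log_poly big_add1 /= big_mkord raddf_sum big_distrr /=.
  apply: eq_bigr => l _; rewrite derivZ deriv_exp -scaler_nat scalerA.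
  by rewrite divfK ?pnatr_eq0 //= [(- v) ^+ l]exprNn signC mul_polyC -scalerAr.
(* The geometric series telescopes; the error term vanishes in degrees up to [n] because [v] has no
   constant term. *)
have key : (log_poly n.+1)^`() * (1 + v) = v^`() - v^`() * (- v) ^+ n.+1.
  have := subrX1 (- v) n.+1; rewrite dlog => /eqP.
  rewrite subr_eq => /eqP->; ring.
have := congr1 (fun p : {poly rat} => p`_n) key.
rewrite /= coefB !coefM [X in _ - X]big1 => [|i _]; last first.
  rewrite exprNn signC coefCM coef_uX_small ?mulr0 ?ltnS ?leq_subr //.
  exact: leq_trans (leq_subr _ _) _.
rewrite subr0 coef_deriv coef_poly ltnSn /= mulr_natl => <-.
rewrite big_add1 /= big_mkord; apply: eq_bigr => i _.
rewrite coef_deriv coef_log_poly; last exact: ltn_ord.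
rewrite -[log_coef _ *+ _]mulr_natl subSS coefD coef1 coef_poly.
rewrite ltnS (leq_trans (leq_subr _ _)) //.
by have [->|_] := eqVneq (n - i)%N 0%N; rewrite ?P0 ?addr0 ?add0r.
Qed.

End Compositions.

(** Since [P 0 = 1], the last term of the recurrence is [c n] itself, so the recurrence determines
    [c]. *)
Lemma log_coef_unique (P : nat -> rat) (c : nat -> rat) : P 0 = 1 ->
  (forall n, n%:R * P n = \sum_(1 <= m < n.+1) c m * P (n - m)%N) ->
  forall n, (0 < n)%N -> c n = n%:R * log_coef P n.
Proof.
move=> P0 cP; elim/ltn_ind => -[//|n] IH _.
have := cP n.+1; rewrite (log_coef_recurrence _ P0).
rewrite [LHS]big_nat_recr // [RHS]big_nat_recr //= subnn P0 !mulr1.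
rewrite [X in X + _ = _]big_nat [X in _ = X + _]big_nat.
rewrite [X in _ = X + _](eq_bigr
   (fun m => m%:R * log_coef P m * P (n.+1 - m)%N)) => [/addrI->//|m /andP[m0 mn]].
by rewrite IH.
Qed.

(** * Eliminating the logarithm by Moebius inversion *)

Section MobiusInversion.
Implicit Types d m n s : nat.

Lemma sum_mobius_rat n : (0 < n)%N ->
  \sum_(d <- divisors n) (mobius d)%:~R = (n == 1%N)%:R :> rat.
Proof.
by move=> n0; rewrite -(rmorph_sum (@intmul rat 1)) /= sum_mobius //; case: eqP.
Qed.

Lemma sum_mobius_delta n (F : nat -> rat) : (0 < n)%N ->
  \sum_(d <- divisors n) F d * \sum_(m <- divisors (n %/ d)) (mobius m)%:~R = F n.
Proof.
move=> n0; rewrite (bigD1_seq n) ?divisors_uniq ?divisors_id //= divnn n0.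
rewrite sum_mobius_rat // eqxx mulr1 big1_seq ?addr0 // => d /andP[dn].
rewrite -dvdn_divisors // => dvd; have d0 := dvdn_gt0 n0 dvd.
rewrite sum_mobius_rat ?divn_dvd_gt0 //.
case: eqP => [E|]; last by rewrite mulr0.
by case/eqP: dn; rewrite -[RHS](divnK dvd) E mul1n.
Qed.

Lemma num_irr_from_log (I l : nat -> rat) :
  (forall m, (0 < m)%N -> m%:R * l m = \sum_(d <- divisors m) d%:R * I d) ->
  forall n, (0 < n)%N ->
  I n = \sum_(m <- divisors n) (mobius m)%:~R / m%:R * l (n %/ m)%N.
Proof.
move=> lI n n0; have nz : n%:R != 0 :> rat by rewrite pnatr_eq0 -lt0n.
apply: (mulfI nz); rewrite -[LHS](sum_mobius_delta (fun d => d%:R * I d) n0).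
under eq_bigr do rewrite big_distrr /=.
rewrite -(big_divisors_exchange (fun m d => d%:R * I d * (mobius m)%:~R)) //.
rewrite big_distrr /=; apply: eq_big_seq => m; rewrite -dvdn_divisors // => mn.
have m0 := dvdn_gt0 n0 mn.
rewrite -big_distrl /= -lI ?divn_dvd_gt0 //.
have -> : n%:R = (n %/ m)%N%:R * m%:R :> rat by rewrite -natrM divnK.
have mz : m%:R != 0 :> rat by rewrite pnatr_eq0 -lt0n.
by field.
Qed.

(** After multiplication by [n] and the substitution [k = s * u], the sum over [u] is [n / s] times
    [l s (n / s)]. Expanded through [a], its first index [s * (n / s / d)] equals [n / d] whatever
    [s] is, so summing [mobius s] leaves only [d = n]. *)
Lemma num_abs_irr_from_log (I l a : nat -> nat -> rat) :
  (forall s m, (0 < s)%N -> (0 < m)%N ->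
     m%:R * l s m = \sum_(d <- divisors m) d%:R * I s d) ->
  (forall s m, (0 < s)%N -> (0 < m)%N ->
     m%:R * l s m = \sum_(d <- divisors m) d%:R * a (s * (m %/ d))%N d) ->
  forall n, (0 < n)%N ->
  a 1%N n = \sum_(k <- divisors n)
     k%:R^-1 * \sum_(s <- divisors k) (mobius s)%:~R * I s (n %/ k)%N.
Proof.
move=> lI la n n0; have nz : n%:R != 0 :> rat by rewrite pnatr_eq0 -lt0n.
apply: (mulfI nz); rewrite big_distrr /=.
transitivity (\sum_(k <- divisors n) \sum_(s <- divisors k)
    (mobius s)%:~R * ((n %/ k)%N%:R * I s (n %/ k)%N)); last first.
  apply: eq_big_seq => k; rewrite -dvdn_divisors // => kn.
  have k0 := dvdn_gt0 n0 kn.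
  have kz : k%:R != 0 :> rat by rewrite pnatr_eq0 -lt0n.
  have -> : n%:R = (n %/ k)%N%:R * k%:R :> rat by rewrite -natrM divnK.
  rewrite mulrA mulfK // big_distrr /=.
  by apply: eq_bigr => s _; rewrite mulrCA.
rewrite big_divisors_nested //.
transitivity (\sum_(s <- divisors n) \sum_(d <- divisors (n %/ s))
    d%:R * a (n %/ d)%N d * (mobius s)%:~R); last first.
  apply: eq_big_seq => s; rewrite -dvdn_divisors // => sn.
  have s0 := dvdn_gt0 n0 sn.
  have ns0 : (0 < n %/ s)%N by apply: divn_dvd_gt0.
  transitivity ((mobius s)%:~R * ((n %/ s)%N%:R * l s (n %/ s)%N)).
    rewrite la // big_distrr /=; apply: eq_big_seq => d.
    rewrite -dvdn_divisors // => dns; rewrite mulrC; congr (_ * (_ * a _ _)).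
    by rewrite muln_divA // mulnC divnK.
  rewrite lI // -big_divisors_rev // big_distrr /=; apply: eq_big_seq => d.
  by rewrite -dvdn_divisors // => dns; rewrite divnMA divnA // mulKn.
rewrite big_divisors_exchange //; under eq_bigr do rewrite -big_distrr /=.
by rewrite (sum_mobius_delta (fun d => d%:R * a (n %/ d)%N d)) // divnn n0.
Qed.

End MobiusInversion.

(** * Finite fields and their algebraic closures *)

(** A repeated root would be a root of the derivative. *)
Lemma uniq_simple_roots (K : fieldType) (s : seq K) :
  (forall z, z \in s -> (\prod_(x <- s) ('X - x%:P))^`().[z] != 0) -> uniq s.
Proof.
elim: s => //= x s IH; rewrite big_cons; set p := \prod_(y <- s) _ => simple.
have derE z : (('X - x%:P) * p)^`().[z] = p.[z] + (z - x) * p^`().[z].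
  by rewrite derivM derivXsubC !hornerE.
have p0 z : z \in s -> p.[z] = 0 by move=> zs; apply/eqP; rewrite -/(root p z) root_prod_XsubC.
apply/andP; split.
  apply/negP => xs; have := simple x; rewrite inE eqxx => /(_ isT).
  by rewrite derE p0 // subrr mul0r addr0 eqxx.
apply: IH => z zs; have := simple z; rewrite inE zs orbT => /(_ isT).
by rewrite derE p0 // add0r mulf_eq0 negb_or => /andP[].
Qed.

Section FrobeniusClosedField.
Variables (K : closedFieldType) (p : nat).

(** The characteristic enters through the argument [pK], on which the morphism structures declared
    below rest. *)
Definition frobenius_pow (pK : p \in [pchar K]) k (x : K) : K := x ^+ (p ^ k).

Hypothesis pK : p \in [pchar K].

Let frobenius_pow_zmod k : zmod_morphism (frobenius_pow pK k).
Proof.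
have nK : [pchar K].-nat (p ^ k)%N.
  by rewrite pnatX (eq_pnat _ (pcharf_eq pK)) pnat_id ?(pcharf_prime pK).
move=> x y; have := exprDn_pchar (x - y) y nK; rewrite subrK /frobenius_pow => ->.
by rewrite addrK.
Qed.

Let frobenius_pow_monoid k : monoid_morphism (frobenius_pow pK k).
Proof. by split=> [|x y]; rewrite /frobenius_pow ?expr1n ?exprMn. Qed.

HB.instance Definition _ k :=
  GRing.isZmodMorphism.Build K K (frobenius_pow pK k) (@frobenius_pow_zmod k).
HB.instance Definition _ k :=
  GRing.isMonoidMorphism.Build K K (frobenius_pow pK k) (@frobenius_pow_monoid k).

Lemma iter_frobenius_pow k j x : iter j (frobenius_pow pK k) x = x ^+ (p ^ (k * j)).
Proof.
elim: j => [|j IH] /=; first by rewrite muln0 expr1.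
by rewrite IH /frobenius_pow -exprM -expnD mulnS addnC.
Qed.

(** Roots of [X^(p ^ k) - y] exist in a closed field and give a right inverse; it is two-sided
    because field morphisms are injective. *)
Lemma frobenius_pow_bij k : bijective (frobenius_pow pK k).
Proof.
have pk0 : (0 < p ^ k)%N by rewrite expn_gt0 prime_gt0 ?(pcharf_prime pK).
have /choice[g gK] : forall y : K, exists x, frobenius_pow pK k x = y.
  move=> y; have : size ('X^(p ^ k) - y%:P) != 1%N.
    by rewrite size_XnsubC // eqSS -lt0n.
  case/closed_rootP => x; rewrite rootE !hornerE subr_eq0 => /eqP xy.
  by exists x.
by exists g => // x; apply: (fmorph_inj (frobenius_pow pK k)); exact: gK.
Qed.

(** The polynomial [X^(p ^ k) - X] splits, and its derivative is -1 in characteristic [p], so its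
    roots are distinct. *)
Lemma frobenius_fixed_seq k : (0 < k)%N ->
  exists s : seq K, [/\ uniq s, size s = (p ^ k)%N &
                        forall x, x \in s <-> x ^+ (p ^ k) = x].
Proof.
move=> k0; have pr := pcharf_prime pK; have p0 := prime_gt0 pr.
have p1 : (1 < p ^ k)%N by rewrite -{1}(exp1n k) ltn_exp2r ?prime_gt1.
pose P : {poly K} := 'X^(p ^ k) - 'X.
have szX : (size (- 'X : {poly K}) < size ('X^(p ^ k) : {poly K}))%N.
  by rewrite size_polyN size_polyX size_polyXn ltnS.
have [s sP] := closed_field_poly_normal P.
have leadP : lead_coef P = 1 by rewrite lead_coefDl // lead_coefXn.
rewrite leadP scale1r in sP.
have rootP x : (x \in s) = (x ^+ (p ^ k) == x).
  by rewrite -root_prod_XsubC -sP rootE !hornerE subr_eq0.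
exists s; split=> [||x]; last by rewrite rootP; split=> /eqP.
  apply: uniq_simple_roots => z _; rewrite -sP derivB derivXn derivX.
  have -> : ('X^((p ^ k).-1) *+ (p ^ k)%N) = 0 :> {poly K}.
    rewrite -mulr_natr -polyC_natr natrX (pcharf0 pK) expr0n (gtn_eqF k0).
    by rewrite mulr0.
  by rewrite sub0r !hornerE oppr_eq0 oner_eq0.
apply: succn_inj; rewrite -(size_prod_XsubC s id) -sP size_polyDl //.
by rewrite size_polyXn.
Qed.

End FrobeniusClosedField.

Section FixedMonic.
Variables (L : fieldType) (r : nat) (tau : {rmorphism L -> L}).
Local Notation T := (map_mpoly tau : {mpoly L[r]} -> {mpoly L[r]}).

Lemma mcoeff_iter_map_mpoly j (f : {mpoly L[r]}) m :
  (iter j T f)@_m = iter j tau f@_m.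
Proof. by elim: j => //= j IH; rewrite mcoeff_map_mpoly IH. Qed.

Lemma iter_map_mpoly_fixed j (f : {mpoly L[r]}) :
  iter j T f = f <-> forall m, iter j tau f@_m = f@_m.
Proof.
split=> [fE m|fE]; first by rewrite -mcoeff_iter_map_mpoly fE.
by apply/mpolyP => m; rewrite mcoeff_iter_map_mpoly.
Qed.

Variables (j : nat) (C : {fset L}).
Hypothesis memC : forall x, x \in C <-> iter j tau x = x.

Let CM : {in C &, forall x y, x * y \in C}.
Proof.
move=> x y /memC xE /memC yE; apply/memC; have -> i : iter i tau (x * y) = iter i tau x * iter i tau y.
  by elim: i => //= i ->; rewrite rmorphM.
by rewrite xE yE.
Qed.

Let CV : {in C, forall x, x^-1 \in C}.
Proof.
move=> x /memC xE; apply/memC; have -> i : iter i tau x^-1 = (iter i tau x)^-1.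
  by elim: i => //= i ->; rewrite fmorphV.
by rewrite xE.
Qed.

Let C0 : 0 \in C.
Proof. by apply/memC; elim: j => //= i ->; rewrite rmorph0. Qed.

Lemma fixed_monicE n : fixed_monic tau j n = monic_coefs_in C n :> set {mpoly L[r]}.
Proof.
apply/seteqP; split=> f [mf].
  by move/iter_map_mpoly_fixed => fE; split=> // m; apply/memC.
by move=> fC; split=> //; apply/iter_map_mpoly_fixed => m; apply/memC.
Qed.

Lemma finite_fixed_monic n : finite_set (fixed_monic tau j n : set {mpoly L[r]}).
Proof. by rewrite fixed_monicE; apply: finite_monic_coefs_in. Qed.

Lemma num_fixed_monicE n : (0 < r)%N -> (1 < #|` C|)%N -> j = 1%N ->
  (num_fixed_monic r tau n)%:R = num_monic r n #|` C|.
Proof.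
move=> r0 C1 j1; rewrite /num_fixed_monic -j1 fixed_monicE.
by apply: num_monicE => //; apply: card_monic_coefs_in.
Qed.

End FixedMonic.

Lemma num_monic0 r Q : (1 < Q)%N -> num_monic r 0 Q = 1.
Proof.
move=> Q1; rewrite /num_monic !addn0 !binn subnn expr0 mul1r expr1 divff //.
rewrite subr_eq0 eq_sym invr_eq1 pnatr_eq1 gtn_eqF //.
Qed.

(** By [fixed_monic_recurrence] the right-hand side satisfies the recurrence that [log_coef_unique]
    solves. *)
Lemma fixed_irr_log (L : fieldType) (r : nat) (tau : {rmorphism L -> L}) (Q : nat) :
  bijective tau ->
  (forall j n, (0 < j)%N -> finite_set (fixed_monic tau j n : set {mpoly L[r]})) ->
  (1 < Q)%N ->
  (forall n, (num_fixed_monic r tau n)%:R = num_monic r n Q) ->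
  forall m, (0 < m)%N ->
  m%:R * log_coef (fun i => num_monic r i Q) m =
  \sum_(d <- divisors m) d%:R * (num_fixed_irr r tau (m %/ d) d)%:R.
Proof.
move=> tau_bij fin Q1 numE m m0.
rewrite -(log_coef_unique (num_monic0 r Q1)
  (c := fun m => \sum_(d <- divisors m) d%:R * (num_fixed_irr r tau (m %/ d) d)%:R)) // => n.
rewrite -numE -natrM fixed_monic_recurrence // natr_sum; apply: eq_bigr => k _.
rewrite natrM numE natr_sum; congr (_ * _).
by apply: eq_bigr => d _; rewrite natrM.
Qed.

Lemma num_irr_log (F : finFieldType) (r m : nat) : (0 < r)%N -> (0 < m)%N ->
  m%:R * log_coef (fun i => num_monic r i #|F|) m =
  \sum_(d <- divisors m) d%:R * (num_irr F r d)%:R.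
Proof.
move=> r0 m0; pose C := fset_set [set: F].
have iter_id j x : iter j (idfun : {rmorphism F -> F}) x = x by elim: j.
have memC j x : x \in C <-> iter j (idfun : {rmorphism F -> F}) x = x.
  by rewrite iter_id (in_fset_setP x finite_finset).
have cardC : #|` C| = #|F|.
  rewrite cardE; apply: card_fset_set_seq (enum_uniq _) _.
    exact: finite_finset.
  by move=> x; rewrite mem_enum.
have F1 : (1 < #|F|)%N := finNzRing_gt1 F.
have fin j n : (0 < j)%N ->
    finite_set (fixed_monic (idfun : {rmorphism F -> F}) j n : set {mpoly F[r]}).
  by move=> _; apply: (finite_fixed_monic _ (memC j)).
have numE n : (num_fixed_monic r (idfun : {rmorphism F -> F}) n)%:R =
    num_monic r n #|F|.
  by rewrite (num_fixed_monicE (memC 1%N)) ?cardC.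
have id_bij : bijective (idfun : {rmorphism F -> F}) by exists id.
rewrite (fixed_irr_log id_bij fin F1 numE m0).
apply: eq_bigr => d _; congr (_ * _%:R); rewrite /num_fixed_irr /num_irr.
suff -> : fixed_irr (idfun : {rmorphism F -> F}) (m %/ d) d = irr_polys d
    :> set {mpoly F[r]} by [].
apply/seteqP; split=> p; first by case.
by move=> pI; split=> //; apply/iter_map_mpoly_fixed => k; rewrite iter_id.
Qed.

(** * Irreducible polynomials over an algebraic closure *)

Section AlgebraicClosure.
Variables (F : finFieldType) (r : nat).
Hypothesis r_gt0 : (0 < r)%N.
Let K : closedFieldType := alg_closure F.
Let iota : {rmorphism F -> K} := to_alg_closure F.

(** The field with [#|F| ^ t] elements is realized inside the closure as the solutions of
    [x ^+ (#|F| ^ t) = x]. *)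
Definition closure_irr t d : set {mpoly K[r]} :=
  [set g | irr_polys d g /\ forall m, g@_m ^+ (#|F| ^ t) = g@_m].

Definition num_closure_irr t d : nat := #|` fset_set (closure_irr t d)|%fset.

Let pchar_closure : exists p e, [/\ p \in [pchar K], (0 < e)%N & #|F| = (p ^ e)%N].
Proof.
have [p pr pF] := finPcharP F.
have [e cF] : exists e, #|F| = (p ^ e)%N by exists (logn p #|F|); apply: card_pprimeChar pF.
exists p, e; split=> //; first by rewrite (fmorph_pchar iota).
rewrite lt0n; apply: contraTneq (finNzRing_gt1 F) => e0.
by rewrite cF e0.
Qed.

Let fixed_fset t : (0 < t)%N -> exists2 C : {fset K},
  #|` C| = (#|F| ^ t)%N & forall x, x \in C <-> x ^+ (#|F| ^ t) = x.
Proof.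
move=> t0; have [p [e [pK e0 ->]]] := pchar_closure.
rewrite -expnM; have [|s [us szs sP]] := @frobenius_fixed_seq K p pK (e * t).
  by rewrite muln_gt0 e0.
exists (seq_fset tt s); last by move=> x; rewrite seq_fsetE.
by rewrite -szs size_seq_fset undup_id.
Qed.

Lemma num_closure_irr_log s m : (0 < s)%N -> (0 < m)%N ->
  m%:R * log_coef (fun i => num_monic r i (#|F| ^ s)) m =
  \sum_(d <- divisors m) d%:R * (num_closure_irr (s * (m %/ d)) d)%:R.
Proof.
move=> s0 m0; have [p [e [pK e0 cF]]] := pchar_closure.
have Q1 : (1 < #|F| ^ s)%N.
  by rewrite -{1}(exp1n s) ltn_exp2r // finNzRing_gt1.
(* Since [#|F| = p ^ e], this is the [#|F| ^ s]-power map. *)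
pose tau : {rmorphism K -> K} := frobenius_pow pK (e * s).
have tauE j x : iter j tau x = x ^+ (#|F| ^ (s * j)).
  by rewrite iter_frobenius_pow cF -expnM mulnA.
have tauC j : (0 < j)%N -> exists2 C : {fset K}, #|` C| = (#|F| ^ (s * j))%N &
    forall x, x \in C <-> iter j tau x = x.
  move=> j0; have [|C cC CP] := @fixed_fset (s * j); first by rewrite muln_gt0 s0.
  by exists C => // x; rewrite tauE.
have fin j n : (0 < j)%N -> finite_set (fixed_monic tau j n : set {mpoly K[r]}).
  by move=> /tauC[C _ CP]; apply: (finite_fixed_monic _ CP).
have numE n : (num_fixed_monic r tau n)%:R = num_monic r n (#|F| ^ s).
  have [//|C cC CP] := tauC 1%N.
  by rewrite (num_fixed_monicE CP) ?cC ?muln1.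
rewrite (fixed_irr_log (frobenius_pow_bij pK _) fin Q1 numE m0).
apply: eq_bigr => d _; congr (_ * _%:R); rewrite /num_fixed_irr /num_closure_irr.
suff -> : fixed_irr tau (m %/ d) d = closure_irr (s * (m %/ d)) d
    :> set {mpoly K[r]} by [].
apply/seteqP; split=> f [fI].
  by move/iter_map_mpoly_fixed => fE; split=> // k; rewrite -tauE.
by move=> fE; split=> //; apply/iter_map_mpoly_fixed => k; rewrite tauE.
Qed.

(** Units are the polynomials of [msize] 1, and [msize] survives extension of scalars, so a
    factorization into nonunits over [F] stays one over the closure. *)
Lemma map_mpoly_irreducible (p : {mpoly F[r]}) :
  irreducible_elt (map_mpoly iota p) -> irreducible_elt p.
Proof.
have unitE (f : {mpoly F[r]}) :
    (map_mpoly iota f \is a GRing.unit) = (f \is a GRing.unit).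
  by rewrite !mpoly_unit_msize msize_map_mpoly.
case=> p0 pU pP; split; rewrite -?unitE //.
  by apply: contraNneq p0 => ->; rewrite rmorph0.
by move=> a b pab; rewrite -!unitE; apply: pP; rewrite pab rmorphM.
Qed.

(** The equation has exactly [#|F|] solutions in the closure, and the image of [F] already provides
    that many. *)
Let in_iota x : x ^+ #|F| = x -> exists c, iota c = x.
Proof.
move=> xE; have [//|C cC CP] := @fixed_fset 1; rewrite expn1 in cC CP.
pose im := map iota (enum F).
have im_uniq : uniq im by rewrite map_inj_uniq ?enum_uniq //; apply: fmorph_inj.
have im_sub : {subset im <= C}.
  by move=> y /mapP[c _ ->]; apply/CP; rewrite -rmorphXn /= expf_card.
have [|_ imE] := uniq_min_size im_uniq im_sub.
  by rewrite cC size_map -cardE.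
have : x \in im by rewrite imE; apply/CP.
by case/mapP=> c _ ->; exists c.
Qed.

(** Extension of scalars is the bijection: by [in_iota], coefficients fixed by the [#|F|]-power map
    come from [F]. *)
Lemma num_abs_irrE d : num_abs_irr F r d = num_closure_irr 1 d.
Proof.
have iotaF c : iota c ^+ #|F| = iota c by rewrite -rmorphXn /= expf_card.
apply: (card_fset_set_bij (f := map_mpoly iota)).
- by apply: sub_finite_set (finite_monic_polys F r d) => p [[]].
- have [//|C _ CP] := @fixed_fset 1.
  have finC : finite_set (monic_coefs_in C d : set {mpoly K[r]}).
    apply: finite_monic_coefs_in; apply/CP.
    by rewrite expr0n gtn_eqF // expn_gt0 ltnW // finNzRing_gt1.
  apply: sub_finite_set finC => g [[mg _] gC].
  by split=> // m; apply/CP.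
- by move=> f g _ _; apply: map_mpoly_inj.
- move=> f [/irr_polysP[[mf _] df] fabs]; split.
    by apply/irr_polysP; rewrite /monic_irr monic_map_mpoly mdegree_map_mpoly.
  by move=> m; rewrite mcoeff_map_mpoly expn1 iotaF.
- move=> g [/irr_polysP[[mg gI] dg] gE].
  have /choice[c cE] : forall m, exists c, iota c = g@_m.
    by move=> m; apply: in_iota; rewrite -[in LHS](expn1 #|F|).
  pose f : {mpoly F[r]} := \sum_(m <- msupp g) c m *: 'X_[m].
  have fg : map_mpoly iota f = g.
    rewrite [RHS]mpolyE raddf_sum; apply: eq_bigr => m _.
    by rewrite /= map_mpolyZ map_mpolyX cE.
  exists f => //; split; last by rewrite /absolutely_irreducible fg.
  apply/irr_polysP; rewrite -(mdegree_map_mpoly iota) fg; split=> //.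
  split; first by rewrite -(monic_map_mpoly iota) fg.
  by apply: map_mpoly_irreducible; rewrite fg.
Qed.

End AlgebraicClosure.

Lemma num_irr0 (F : finFieldType) r : num_irr F r 0 = 0%N.
Proof.
rewrite /num_irr; suff -> : irr_polys 0 = set0 :> set {mpoly F[r]} by rewrite fset_set0.
apply/seteqP; split=> // p /irr_polysP[/monic_irr_mdegree]; rewrite lt0n.
by move/eqP.
Qed.

Lemma num_rel_irrE (F : finFieldType) r d :
  num_irr F r d = (num_abs_irr F r d + num_rel_irr F r d)%N.
Proof.
have finI : finite_set (irr_polys d : set {mpoly F[r]}).
  by apply: sub_finite_set (finite_monic_polys F r d) => p [].
have absI : (abs_irr_polys d `<=` (irr_polys d : set {mpoly F[r]}))%classic.
  by move=> p [].
have finA := sub_finite_set absI finI.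
rewrite /num_rel_irr /rel_irr_polys fset_setD // cardfsDS -?fset_set_sub //.
by rewrite subnKC // fsubset_leq_card // -fset_set_sub.
Qed.

(** * The formulas for absolutely and relatively irreducible polynomials *)

Theorem theorem6p2 (r n q : nat) (hr : (1 <= r)%N) (hn : (1 <= n)%N)
    (hq : prime_power q)
    (GF : nat -> finFieldType)
    (hGF : forall s : nat, (0 < s)%N -> #|GF s| = (q ^ s)%N) :
  [/\ num_abs_irr (GF 1%N) r 0 = 0%N,
      num_rel_irr (GF 1%N) r 0 = 0%N,
      (num_abs_irr (GF 1%N) r n)%:R =
        - (\sum_(k <- divisors n) \sum_(s <- divisors k)
             (mobius s)%:~R / k%:R *
             \sum_(m <- divisors (n %/ k))
               (mobius m)%:~R / m%:R *
               \sum_(j <- compositions (n %/ (k * m)))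
                 (-1) ^+ size j / (size j)%:R *
                 \prod_(a <- j) num_monic r a (q ^ s)) :> rat,
      (num_rel_irr (GF 1%N) r n)%:R =
        - (\sum_(k <- divisors n | (1 < k)%N)
             k%:R^-1 *
             \sum_(s <- divisors k)
               (mobius s)%:~R * (num_irr (GF s) r (n %/ k))%:R) :> rat
    & - (\sum_(k <- divisors n | (1 < k)%N)
           k%:R^-1 *
           \sum_(s <- divisors k)
             (mobius s)%:~R * (num_irr (GF s) r (n %/ k))%:R) =
        \sum_(k <- divisors n | (1 < k)%N)
          k%:R^-1 *
          \sum_(s <- divisors k) \sum_(m <- divisors (n %/ k))
            ((mobius s)%:~R * (mobius m)%:~R) / m%:R *
            \sum_(j <- compositions (n %/ (k * m)))
              (-1) ^+ size j / (size j)%:R *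
              \prod_(a <- j) num_monic r a (q ^ s) :> rat].
Proof.
pose I s d : rat := (num_irr (GF s) r d)%:R.
(* [l s] depends only on [q ^ s]. It links the counts over [GF s] with those over the closure of
   [GF 1], so no embeddings between the fields [GF s] are involved. *)
pose l s := log_coef (fun i => num_monic r i (q ^ s)).
have lI s m : (0 < s)%N -> (0 < m)%N ->
    m%:R * l s m = \sum_(d <- divisors m) d%:R * I s d.
  by move=> s0 m0; rewrite /l -hGF // num_irr_log.
pose a t d : rat := (num_closure_irr (GF 1%N) r t d)%:R.
have la s m : (0 < s)%N -> (0 < m)%N ->
    m%:R * l s m = \sum_(d <- divisors m) d%:R * a (s * (m %/ d))%N d.
  by move=> s0 m0; rewrite /l -num_closure_irr_log // hGF // expn1.
have IE s d : (0 < s)%N -> (0 < d)%N -> I s d =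
    - \sum_(m <- divisors d) (mobius m)%:~R / m%:R *
        \sum_(j <- compositions (d %/ m))
          (-1) ^+ size j / (size j)%:R * \prod_(a <- j) num_monic r a (q ^ s).
  move=> s0 d0; rewrite (num_irr_from_log (lI s ^~ s0)) // -sumrN.
  by apply: eq_bigr => m _; rewrite /l /log_coef mulrN.
have aE : (num_abs_irr (GF 1%N) r n)%:R = \sum_(k <- divisors n)
    k%:R^-1 * \sum_(s <- divisors k) (mobius s)%:~R * I s (n %/ k)%N.
  by rewrite num_abs_irrE -(num_abs_irr_from_log lI la).
have [A0 R0] : num_abs_irr (GF 1%N) r 0 = 0%N /\ num_rel_irr (GF 1%N) r 0 = 0%N.
  have /eqP := num_rel_irrE (GF 1%N) r 0.
  by rewrite num_irr0 eq_sym addn_eq0 => /andP[/eqP-> /eqP->].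
split=> //.
- rewrite aE -sumrN; apply: eq_big_seq => k; rewrite -dvdn_divisors // => kn.
  have k0 := dvdn_gt0 hn kn; rewrite big_distrr -sumrN /=.
  apply: eq_big_seq => s; rewrite -dvdn_divisors // => sk.
  rewrite IE ?divn_dvd_gt0 ?(dvdn_gt0 k0 sk) // -mulrN mulrCA mulrA; congr (_ * - _).
  by apply: eq_bigr => m _; rewrite -divnMA.
- have relE : (num_rel_irr (GF 1%N) r n)%:R = I 1%N n - (num_abs_irr (GF 1%N) r n)%:R.
    by rewrite /I num_rel_irrE natrD addrAC subrr add0r.
  (* The term [k = 1] of [aE] is [I 1 n], which cancels the number of all irreducibles. *)
  rewrite relE aE (bigD1_seq 1%N) ?divisors_uniq ?divisor1 //=.
  rewrite big_seq1 invr1 mul1r divn1 mul1r opprD addrA subrr add0r; congr (- _).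
  rewrite [LHS]big_seq_cond [RHS]big_seq_cond; apply: eq_bigl => k.
  have [|//] := boolP (k \in divisors n); rewrite -dvdn_divisors // => kn.
  by rewrite /= ltn_neqAle eq_sym (dvdn_gt0 hn kn) andbT.
- rewrite -sumrN [LHS]big_seq_cond [RHS]big_seq_cond; apply: eq_bigr => k.
  rewrite -dvdn_divisors // => /andP[kn _]; have k0 := dvdn_gt0 hn kn.
  rewrite -mulrN -sumrN; congr (_ * _); apply: eq_big_seq => s.
  rewrite -dvdn_divisors // => sk.
  rewrite -/(I s _) IE ?divn_dvd_gt0 ?(dvdn_gt0 k0 sk) // mulrN opprK big_distrr /=.
  by apply: eq_bigr => m _; rewrite -divnMA !mulrA.
Qed.
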